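(* Let $q\in L^1(\mathbb{R}_+)$ be real-valued and compactly supported, with Jost solution $f(x,k)$. The data $f'(0,k)$, known on an arbitrarily small nonempty open subset of $(0,\infty)$, or even only on an infinite sequence of distinct positive numbers $k_n$ which has a limit point $k>0$, determine $q$ uniquely. That is, if $q_1,q_2\in L^1(\mathbb{R}_+)$ are real-valued and compactly supported and the corresponding functions $f_1'(0,k)$, $f_2'(0,k)$ coincide on such a set, then $q_1=q_2$ almost everywhere.
   Context: $\mathbb{R}_+=(0,\infty)$. The Jost solution $f(x,k)$ is the unique solution of $u''+k^2u-q(x)u=0$ on $x>0$ with $f(x,k)=e^{ikx}+o(1)$ as $x\to+\infty$; $f'(0,k):=\frac{\partial f}{\partial x}(0,k)$. *)

(* Defs.v *)
From HB Require Import structures.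
From mathcomp Require Import all_boot all_order all_algebra.
From mathcomp Require Import complex.
From mathcomp Require Import all_classical all_reals all_analysis.

Set Implicit Arguments.
Unset Strict Implicit.
Unset Printing Implicit Defensive.

Import Order.TTheory GRing.Theory Num.Theory.
Import numFieldNormedType.Exports.

Local Open Scope classical_set_scope.
Local Open Scope ring_scope.
Local Open Scope complex_scope.

(* Derivatives are taken along the half-line [0, +oo[: for 0 < x the filter
   below is the full punctured neighbourhood of 0, so one gets the usual
   derivative; for x = 0 one gets the right derivative. Values of functions on
   the negative half-line are never used. *)
Definition diffquot (R : realType) (u : R -> R) (x : R) : set_system R :=
  (u (x + h) - u x) / h @[h --> within [set h | 0 <= x + h] (0 : R)^'].

Definition half_derivable (R : realType) (u : R -> R) (x : R) : Prop :=
  cvg (diffquot u x).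

Definition half_derive (R : realType) (u : R -> R) (x : R) : R :=
  lim (diffquot u x).

(* Complex-valued functions of a real variable are differentiated
   componentwise. *)
Definition cderivable (R : realType) (f : R -> R[i]) (x : R) : Prop :=
  half_derivable (fun t => complex.Re (f t)) x /\
  half_derivable (fun t => complex.Im (f t)) x.

Definition cderive (R : realType) (f : R -> R[i]) (x : R) : R[i] :=
  half_derive (fun t => complex.Re (f t)) x +i*
  half_derive (fun t => complex.Im (f t)) x.

Definition abs_continuous (R : realType) (a b : R) (u : R -> R) : Prop :=
  forall e : R, 0 < e -> exists2 d : R, 0 < d &
    forall (n : nat) (s t : 'I_n -> R),
      (forall i, a <= s i <= t i /\ t i <= b) ->
      trivIset setT (fun i => `]s i, t i[%classic) ->
      \sum_(i < n) (t i - s i) < d ->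
      \sum_(i < n) `|u (t i) - u (s i)| < e.

(* As q is only integrable, solutions are in the Caratheodory sense: u is
   differentiable on [0, +oo[, u' is absolutely continuous on each [0, b], and
   the equation holds at almost every x > 0. *)
Record schrodinger_solution (R : realType) (q : R -> R) (k : R)
    (u : R -> R[i]) : Prop := SchrodingerSolution {
  sol_derivable : forall x : R, 0 <= x -> cderivable u x ;
  sol_abs_continuous : forall b : R, 0 < b ->
    abs_continuous 0 b (fun x => complex.Re (cderive u x)) /\
    abs_continuous 0 b (fun x => complex.Im (cderive u x)) ;
  sol_equation : {ae @lebesgue_measure R, forall x : R, 0 < x ->
    cderivable (cderive u) x /\
    cderive (cderive u) x + (k ^+ 2)%:C * u x - (q x)%:C * u x = 0}
}.

(* cos (k x) +i* sin (k x) is e^{ikx}, for real k. *)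
Definition jost_solution (R : realType) (q : R -> R) (k : R)
    (u : R -> R[i]) : Prop :=
  schrodinger_solution q k u /\
  Normc.normc (u x - (cos (k * x) +i* sin (k * x))) @[x --> +oo] --> (0 : R).

(* Support in the a.e. sense: q vanishes almost everywhere on ]0, +oo[ outside
   a compact set. The compact set may contain 0, i.e. the support of q need not
   stay away from the endpoint. *)
Definition compactly_supported (R : realType) (q : R -> R) : Prop :=
  exists2 K : set R, compact K &
    {ae @lebesgue_measure R, forall x : R, 0 < x -> ~ K x -> q x = 0}.

(* Main.v *)
Require Import Defs.
From HB Require Import structures.
From mathcomp Require Import all_boot all_order all_algebra.
From mathcomp Require Import complex.
From mathcomp Require Import all_classical all_reals all_analysis.
From mathcomp Require Import measurable_realfun.
From mathcomp Require Import ring lra.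

Set Implicit Arguments.
Unset Strict Implicit.
Unset Printing Implicit Defensive.

Import Order.TTheory GRing.Theory Num.Theory.
Import numFieldNormedType.Exports.

Local Open Scope classical_set_scope.
Local Open Scope ring_scope.
Local Notation mu := (@lebesgue_measure _).

(* All the data are used through real-valued functions of a real frequency k;
   no analytic continuation in k is needed.

   Fix a with q1 = q2 = 0 almost everywhere beyond a, and p := q1 - q2.  If f is
   the Jost solution of q and P := f'(0,k), then Im (P * conj f) / k is the
   solution phi of the equation with phi(0) = 1, phi'(0) = 0: its value at 0 is
   given by the Wronskian of f and conj f, which is constant.  Beyond a one has
   f = e^{ikx}, so there phi depends on P only.  Hence, at every frequency k
   where the data agree, phi1 and phi2 have the same Cauchy data at 0 and at a,
   and the Wronskian identity gives int_0^a p phi1 phi2 = 0.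

   The function U(x,t) = sum_i c_i phi(x,k_i) cos(k_i t) solves the wave equation
   U_tt = U_xx - q U with U(0,t) = theta(t) := sum_i c_i cos(k_i t), so
   d'Alembert's formula and Gronwall's lemma give
     |U(x,t) - (theta(t+x) + theta(t-x)) / 2| <= C int_{t-x}^{t+x} |theta|.
   Used for q1 and then for q2, this estimate compares
   sum_i c_i phi1(x,k_i) phi2(x,k_i) with (theta(2x) + theta(0)) / 2, up to
   C int_0^{2x} |theta|, and so bounds int_0^a p(x) (theta(2x) + theta(0)) dx.

   If the k_i range over a set with a limit point, the functions theta(2x)
   approximate the indicators of intervals: Taylor expansion around the limit
   point yields all the frequencies, hence all polynomials in cos(pi x / a).
   In the limit |int_]al,be] p| <= C (be - al) int_al^a |p|, so that
   |p(x)| <= C int_x^a |p| almost everywhere, and p = 0. *)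

(** * Fundamental theorem of calculus for absolutely continuous functions *)

(** As [q] is only integrable, u' is merely absolutely continuous, so the Wronskian and Duhamel
    identities rest on a fundamental theorem of calculus for the epsilon-delta notion
    [abs_continuous].

    The estimate on U plays the part of a transformation operator phi(x,k) = cos(kx) + int_0^x
    K(x,t) cos(kt) dt with bounded kernel K, which is never constructed. Its constant depends on q
    and a only. This uniformity is essential: the c_i come from divided differences and blow up as
    the frequencies approach the limit point, while the right-hand side sees nothing but an L^1 norm
    of theta.

    The bound is also causal: the error at x involves theta(2y) for y <= x only. When theta(2x) is
    close to the indicator of ]al,be], the error is negligible for x < al and of order be - al for x
    >= al. This gives a Volterra inequality for p, which forces p = 0, where an integral over all of
    [0,a] would only do so for small potentials. The term theta(0) is lost in the limit because the
    indicator vanishes at 0; hence the approximation has to control the value at 0 as well as an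
    integral distance. *)

(** Supremum argument. The step is asked between any two nearby points s <= x <= t because, as in
    Cousin's lemma, the estimates of [ac_FTC] hold on short intervals containing the tag x. *)
Lemma continuous_induction (R : realType) (a b : R) (P : R -> Prop) :
  a <= b -> P a ->
  (forall x : R, a <= x <= b -> exists2 r : R, 0 < r & forall s t : R,
     a <= s -> s <= x -> x <= t -> t <= b -> x - r < s -> t < x + r ->
     P s -> P t) ->
  P b.
Proof.
move=> ab Pa step.
pose S := [set y | a <= y <= b /\ P y].
have Sa : S a by split => //; rewrite lexx.
have supS : has_sup S.
  by split; [exists a | exists b => y [/andP[]]].
have aS : a <= sup S by apply: ub_le_sup => //; exact: supS.2.
have Sb : sup S <= b by apply: ge_sup; [exists a | move=> y [/andP[]]].
have [|r r0 stepr] := step (sup S); first by rewrite aS Sb.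
have [s [[/andP[as_ sb] Ps] sS]] : exists s, S s /\ sup S - r < s.
  by have [s Ss sr] := sup_adherent r0 supS; exists s.
have sleS : s <= sup S.
  by apply: ub_le_sup; [exact: supS.2 | split=> //; rewrite as_ sb].
case: (ltP (sup S) b) => [Sltb|bleS]; last first.
  have -> : b = sup S by apply/eqP; rewrite eq_le bleS Sb.
  by apply: (stepr s) => //; rewrite ltrDl.
pose t := Num.min b (sup S + r / 2).
have St : sup S < t by rewrite lt_min Sltb ltrDl divr_gt0.
have : S t.
  split.
    by rewrite (le_trans aS (ltW St)) /= ge_min lexx.
  apply: (stepr s) => //; first exact: ltW.
    by rewrite ge_min lexx.
  by rewrite gt_min; apply/orP; right; rewrite ltrD2l ltr_pdivrMr// ltr_pMr// ltr1n.
move=> /(ub_le_sup supS.2); rewrite leNgt St. by [].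
Qed.

(** Lists grow by one interval at a time, which suits an induction better than families over ['I_n].
    The order condition puts the most recent, rightmost interval at the head. *)
Lemma abs_continuous_seq (R : realType) (a b : R) (F : R -> R) :
  abs_continuous a b F ->
  forall e : R, 0 < e -> exists2 d : R, 0 < d & forall l : seq (R * R),
    all (fun p => (a <= p.1 <= p.2) && (p.2 <= b)) l ->
    pairwise (fun p q => q.2 <= p.1) l ->
    \sum_(p <- l) (p.2 - p.1) < d ->
    \sum_(p <- l) `|F p.2 - F p.1| < e.
Proof.
move=> acF e e0; have [d d0 dP] := acF e e0; exists d => // l lab lpw ld.
have := dP (size l) (fun i => (tnth (in_tuple l) i).1)
  (fun i => (tnth (in_tuple l) i).2).
rewrite -!(big_tnth _ _ l predT (fun p => p.2 - p.1)).
rewrite -!(big_tnth _ _ l predT (fun p => `|F p.2 - F p.1|)).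
apply => //.
- move=> i; have /allP/(_ (tnth (in_tuple l) i)) := lab.
  by rewrite mem_tnth => /(_ isT)/andP.
- suff tri : forall i j : 'I_(size l), (i < j)%N ->
    (tnth (in_tuple l) j).2 <= (tnth (in_tuple l) i).1.
    move=> i j _ _ [x []]; rewrite /= !in_itv /= => /andP[x1 x2] /andP[x3 x4].
    case: (ltngtP i j) => [/tri|/tri|/val_inj//] ij.
      by have := lt_trans (le_lt_trans ij x1) x4; rewrite ltxx.
    by have := lt_trans (le_lt_trans ij x3) x2; rewrite ltxx.
  move=> i j ij; rewrite !(tnth_nth (0, 0)) /=.
  by move/(pairwiseP (0, 0)) : lpw; apply => //; rewrite inE.
Qed.

Lemma le_Rintegral_subset d (T : measurableType d) (R : realType)
    (mu : {measure set T -> \bar R}) (A B : set T) (f : T -> R) :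
  measurable A -> measurable B -> A `<=` B ->
  mu.-integrable B (EFin \o f) -> (forall x, B x -> 0 <= f x) ->
  \int[mu]_(x in A) f x <= \int[mu]_(x in B) f x.
Proof.
move=> mA mB AB intf f0; rewrite /Rintegral fine_le//.
- by apply: integrable_fin_num => //; exact: integrableS intf.
- exact: integrable_fin_num.
- apply: ge0_subset_integral => //.
  exact: measurable_int intf.
Qed.

Lemma is_derive0_small (R : realType) (H : R -> R) (x e : R) :
  is_derive x 1 H 0 -> 0 < e ->
  exists2 r, 0 < r & forall z, `|z - x| < r -> `|H z - H x| <= e * `|z - x|.
Proof.
move=> dH e0.
have : h^-1 *: (H (h *: 1 + x) - H x) @[h --> 0^'] --> (0 : R).
  have := @ex_derive _ _ _ _ _ _ _ dH.
  rewrite /derivable => /cvg_ex[l hl].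
  suff l0 : l = 0 by rewrite [X in _ --> X](_ : _ = l).
  by rewrite -(@derive_val _ _ _ _ _ _ _ dH); apply/esym/cvg_lim.
move=> /cvgrPdist_le/(_ _ e0)[r /= r0 hr].
exists r => // z zr; have [->|zx] := eqVneq z x; first by rewrite !subrr normr0 mulr0.
have zx0 : z - x != 0 by rewrite subr_eq0.
have := hr (z - x); rewrite /= !sub0r !normrN => /(_ zr zx0).
rewrite [_ *: 1]mulr1 subrK normrZ normfV.
by rewrite mulrC ler_pdivrMr// normr_gt0.
Qed.

Lemma measure_open_cover_null (R : realType) (D : set R) (d : R) :
  measurable D -> lebesgue_measure D = 0%E -> 0 < d ->
  exists U : set R, [/\ open U, D `<=` U & (lebesgue_measure U < d%:E)%E].
Proof.
move=> mD D0 d0.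
have Dy : (@lebesgue_measure R D < +oo)%E by rewrite D0 ltry.
have [U [oU DU Ud]] := lebesgue_regularity_outer mD Dy d0.
exists U; split => //; apply: le_lt_trans Ud.
have mU : measurable U by exact: open_measurable.
have mUD : measurable (U `\` D) by exact: measurableD.
have := measureU2 (@lebesgue_measure R) mD mUD.
by rewrite setDUK// [X in (_ <= X + _)%E]D0 add0e.
Qed.



(** The arithmetic of [ac_FTC] is isolated over plain variables, so that [lra] meets no integral or
    sum. Here f and g are the increments of F and of the integral of r over a step, S is the sum
    over the recorded list, and K1, K2 are the masses of |r| on the cover before and after the
    step. *)
Lemma covered_step_estimate (R : realType) (x f g h e1 e2 K1 K2 I S : R) : e1 <= e2 ->
  x <= f + g + h -> g <= I -> K1 + I <= K2 -> h <= e1 + S + K1 ->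
  x <= e2 + (f + S) + K2.
Proof. lra. Qed.

Lemma tagged_step_estimate (R : realType) (x p q h e e1 e2 e3 K1 K2 S : R) : e = e1 + e2 + e3 ->
  x <= p + q + h -> p <= e2 -> q <= e3 -> K1 <= K2 -> h <= e1 + S + K1 ->
  x <= e + S + K2.
Proof. lra. Qed.

Lemma cover_estimate (R : realType) (x e c K S : R) : x <= e * c + S + K ->
  S < e -> K < e -> x <= e * (c + 2).
Proof. lra. Qed.

(* The exceptional null set is covered by an open set U of small measure. In
   the continuous induction, steps inside U are recorded in the list l, whose
   contribution is small by absolute continuity of F and of the integral of r;
   the other steps cost at most e times their length. *)
Lemma ac_FTC (R : realType) (F r : R -> R) (a b : R) : a <= b ->
  abs_continuous a b F ->
  (@lebesgue_measure R).-integrable setT (EFin \o r) ->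
  {ae @lebesgue_measure R, forall x, a < x < b -> is_derive x 1 F (r x)} ->
  \int[lebesgue_measure]_(x in `[a, b]) r x = F b - F a.
Proof.
move=> ab acF intr aeF.
pose G (x : R) : R := \int[mu]_(t in [set` Interval (BLeft a) (BRight x)]) r t.
pose H (x : R) : R := F x - G x.
have intS A : measurable A -> mu.-integrable A (EFin \o r).
  by move=> mA; exact: integrableS intr.
have intSn A : measurable A -> mu.-integrable A (EFin \o (fun x => `|r x|)).
  by move=> mA; have := integrable_norm (intS A mA).
have locr : locally_integrable [set: R] r.
  by apply: open_integrable_locally => //; exact: openT.
have aeG : {ae mu, forall x : R, (BLeft a < BRight x)%E ->
    derivable G x 1 /\ G^`()%classic x = r x}.
  exact: (FTC1 (fun y => intS _ (measurable_itv _)) locr).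
have [N [mN N0 NP]] := @filterI _ _ (ae_filter_ringOfSetsType _) _ _ aeF aeG.
have Ga : G a = 0 by rewrite /G set_itv1 Rintegral_set1.
have GB s t : a <= s -> s <= t -> G t - G s = \int[mu]_(x in `]s, t]) r x.
  by move=> as_ st; rewrite /G Rintegral_itvB//; exact: intS.
have HE z : H z = F z - G z by [].
have HD (x : R) : is_derive x 1 F (r x) -> is_derive x 1 G (r x) -> is_derive x 1 H 0.
  by move=> dF dG; rewrite -(subrr (r x)); exact: is_deriveB.
rewrite -/(G b); clearbody H; clearbody G.
(* The factor b - a + 2 collects e (b - a) from the uncovered steps, one e from the variation of F
   on the recorded intervals and one e from the mass of |r| on the cover. *)
suff HH (e : R) : 0 < e -> `|H b - H a| <= e * (b - a + 2).
  have : `|H b - H a| <= 0.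
    apply/ler_addgt0Pr => e e0; rewrite add0r.
    have ba2 : 0 < b - a + 2 by rewrite ltr_wpDl// subr_ge0.
    have := HH (e / (b - a + 2)); rewrite divfK ?gt_eqF//; apply.
    exact: divr_gt0.
  rewrite normr_le0 subr_eq0 !HE Ga subr0 => /eqP <-.
  by rewrite opprB addrC subrK.
move=> e0.
have [d1 d10 ac1] := abs_continuous_seq acF e0.
have [d2 [d20 ac2]] := integral_normr_continuous intr e0.
(* The endpoints join the null set because the derivative of F is known only strictly between them:
   a point outside U is then interior and differentiable for both F and G. *)
have mD : measurable (N `|` [set a; b]) by apply: measurableU => //; exact: measurableU.
have D0 : mu (N `|` [set a; b]) = 0%E.
  apply/null_set_setU => //; first exact: measurableU.
  by apply/null_set_setU => //; exact: lebesgue_measure_set1.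
have d0 : 0 < Num.min d1 d2 by rewrite lt_min d10 d20.
have [U [oU DU Ud]] := measure_open_cover_null mD D0 d0.
have mU : measurable U by exact: open_measurable.
pose A y := U `&` `]-oo, y]%classic.
have mA y : measurable (A y) by apply: measurableI.
pose K (y : R) : R := \int[mu]_(x in A y) `|r x|.
have AU y d : Num.min d1 d2 <= d -> (mu (A y) < d%:E)%E.
  move=> dd; apply: le_lt_trans (lt_le_trans Ud _); last by rewrite lee_fin.
  have AyU : A y `<=` U by exact: subIsetl.
  by rewrite le_measure ?inE; [|exact: mA|exact: mU|exact: AyU].
have leA s t : s <= t -> A s `<=` A t.
  by move=> st x [Ux xs]; split => //; move: xs; rewrite /= !in_itv/= => /le_trans; apply.
have Adis s t : A s `&` `]s, t]%classic = set0.
  rewrite -subset0 => z [[_]]; rewrite /= !in_itv/= => zs /andP[sz _].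
  by have := le_lt_trans zs sz; rewrite ltxx.
have Asub s t : s <= t -> `]s, t]%classic `<=` U -> A s `|` `]s, t]%classic `<=` A t.
  move=> st stU z [/(leA _ _ st)//|zst]; split; first exact: stU.
  by move: zst; rewrite /= !in_itv/= => /andP[].
have mAU s t : measurable (A s `|` `]s, t]%classic).
  by apply: measurableU => //; exact: mA.
have Kmono (s t : R) : s <= t -> K s <= K t.
  by move=> st; apply: le_Rintegral_subset => //;
    [exact: mA|exact: mA|exact: leA|apply: intSn; exact: mA].
have Kadd (s t : R) : s <= t -> `]s, t]%classic `<=` U ->
    K s + \int[mu]_(x in `]s, t]) `|r x| <= K t.
  move=> st stU.
  rewrite -Rintegral_setU//; [|exact: mA|apply: intSn; exact: mAU|exact/disj_set2P].
  by apply: le_Rintegral_subset => //; [exact: mAU|exact: mA|exact: Asub|apply: intSn; exact: mA].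
have Kb : K b < e by apply: ac2; [exact: mA|apply: AU; rewrite ge_min lexx orbT].
have K0 y : 0 <= K y by apply: Rintegral_ge0.
clearbody K.
(* The total length of the list is compared with the measure of the cover up to y, a quantity that
   grows along with it. It is turned into a bound by the modulus [d1] only once y = b is reached. *)
pose P (y : R) := exists l : seq (R * R), [/\
  all (fun p => (a <= p.1 <= p.2) && (p.2 <= y)) l,
  pairwise (fun p q => q.2 <= p.1) l,
  ((\sum_(p <- l) (p.2 - p.1))%:E <= mu (A y))%E &
  `|H y - H a| <= e * (y - a) + \sum_(p <- l) `|F p.2 - F p.1| + K y].
have : P b.
  apply: (@continuous_induction _ a b) => //.
    exists [::]; split => //; rewrite ?big_nil ?measure_ge0//.
    by rewrite !subrr normr0 mulr0 !add0r.
  move=> x /andP[ax xb].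
  have [Ux|NUx] := pselect (U x).
    have [rho /= rho0 rhoU] : \forall y \near x, U y by apply: oU.
    exists rho => // s t as_ sx xt tb rs tr [l [l1 l2 l3 l4]].
    have st := le_trans sx xt.
    have itU : `]s, t]%classic `<=` U.
      move=> z; rewrite /= in_itv/= => /andP[sz zt]; apply: rhoU => /=.
      rewrite ltr_norml; apply/andP; split; clear - sx xt rs tr sz zt; lra.
    exists ((s, t) :: l); split => /=.
    - rewrite as_ st lexx/=; apply/allP => p /(allP l1) /andP[->/= pt].
      exact: le_trans pt st.
    - by rewrite l2 andbT; apply/allP => p /(allP l1) /andP[_].
    - rewrite big_cons EFinD /=.
      apply: (@le_trans _ _ (mu (A s `|` `]s, t]%classic))); last first.
        by rewrite le_measure ?inE; [|exact: mAU|exact: mA|exact: Asub].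
      have -> : mu (A s `|` `]s, t]%classic) = (mu (A s) + mu `]s, t]%classic)%E.
        by apply: measureU => //; exact: mA.
      rewrite addeC leeD//.
      by rewrite lebesgue_measure_itv/= lte_fin; case: ltP => // ts; rewrite lee_fin subr_le0.
    - rewrite big_cons/=.
      have KK := Kadd s t st itU.
      have Gst : `|G t - G s| <= \int[mu]_(x in `]s, t]) `|r x|.
        by rewrite GB//; apply: le_normr_Rintegral => //; exact: intS.
      have tri : `|H t - H a| <= `|F t - F s| + `|G t - G s| + `|H s - H a|.
        have -> : H t - H a = (F t - F s) - (G t - G s) + (H s - H a) by rewrite !HE; clear; ring.
        by rewrite (le_trans (ler_normD _ _))// lerD2r ler_normB.
      have est : e * (s - a) <= e * (t - a) by rewrite ler_pM2l// lerD2r.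
      exact: (covered_step_estimate est tri Gst KK l4).
  have xa : a < x.
    by rewrite lt_neqAle ax andbT; apply/eqP => ax'; apply: NUx; apply: DU; right; left.
  have xb' : x < b.
    by rewrite lt_neqAle xb andbT; apply/eqP => ax'; apply: NUx; apply: DU; right; right.
  have [/= dF dG] : is_derive x (1 : R) F (r x) /\ (derivable G x 1 /\ G^`()%classic x = r x).
    have : ~ N x by move=> Nx; apply: NUx; apply: DU; left.
    move=> /(contra_notP (NP x))[h1 h2]; split; first by apply: h1; rewrite xa xb'.
    by apply: h2; rewrite /= lte_fin.
  have dH : is_derive x (1 : R) H 0.
    apply: HD => //.
    by case: dG => dG <-; rewrite derive1E; exact: DeriveDef.
  have [rho rho0 rhoH] := is_derive0_small dH e0.
  exists rho => // s t as_ sx xt tb rs tr [l [l1 l2 l3 l4]].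
  have st := le_trans sx xt.
  exists l; split => //.
  - by apply/allP => p /(allP l1) /andP[->/= pt]; exact: le_trans pt st.
  - by apply: le_trans l3 _; rewrite le_measure ?inE; [|exact: mA|exact: mA|exact: leA].
  - have KK := Kmono s t st.
    have h1 : `|H t - H x| <= e * (t - x).
      have := rhoH t; rewrite ger0_norm; last by rewrite subr_ge0.
      by apply; clear - sx xt rs tr; lra.
    have h2 : `|H s - H x| <= e * (x - s).
      have := rhoH s; rewrite ler0_norm ?opprB; last by rewrite subr_le0.
      by apply; clear - sx xt rs tr; lra.
    have tri : `|H t - H a| <= `|H t - H x| + `|H s - H x| + `|H s - H a|.
      have -> : H t - H a = (H t - H x) - (H s - H x) + (H s - H a) by clear; ring.
      by rewrite (le_trans (ler_normD _ _))// lerD2r ler_normB.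
    have est : e * (t - a) = e * (s - a) + e * (t - x) + e * (x - s) by clear; ring.
    exact: (tagged_step_estimate est tri h1 h2 KK l4).
move=> [l [l1 l2 l3 l4]].
have lF := ac1 _ l1 l2 _.
have {}lF' : \sum_(p <- l) `|F p.2 - F p.1| < e.
  apply: lF; rewrite -lte_fin; apply: le_lt_trans l3 _; apply: AU.
  by rewrite ge_min lexx.
exact: (cover_estimate l4 lF' Kb).
Qed.

Lemma ae_imply (R : realType) (P Q : R -> Prop) :
  {ae @lebesgue_measure R, forall x, P x} -> (forall x, P x -> Q x) ->
  {ae @lebesgue_measure R, forall x, Q x}.
Proof.
move=> aeP PQ; apply: filterS aeP => //.
exact: (ae_filter_ringOfSetsType (@lebesgue_measure R)).
Qed.

Lemma ae_imply2 (R : realType) (P1 P2 Q : R -> Prop) :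
  {ae @lebesgue_measure R, forall x, P1 x} ->
  {ae @lebesgue_measure R, forall x, P2 x} -> (forall x, P1 x -> P2 x -> Q x) ->
  {ae @lebesgue_measure R, forall x, Q x}.
Proof.
move=> aeP1 aeP2 PQ.
apply: filterS2 aeP1 aeP2 => //.
exact: (ae_filter_ringOfSetsType (@lebesgue_measure R)).
Qed.

Lemma ac_FTC_itv (R : realType) (F r : R -> R) (a b : R) : a <= b ->
  abs_continuous a b F ->
  mu.-integrable `[a, b] (EFin \o r) ->
  {ae @lebesgue_measure R, forall x : R, a < x < b -> is_derive x (1 : R) F (r x)} ->
  \int[mu]_(x in `[a, b]) r x = F b - F a.
Proof.
move=> ab acF intr aeF.
have intr' : (@lebesgue_measure R).-integrable setT (EFin \o (r \_ `[a, b])).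
  by rewrite -restrict_EFin -integrable_mkcond.
rewrite -(ac_FTC ab acF intr').
  by apply: eq_Rintegral => x xab; rewrite patchE xab.
apply: (ae_imply aeF) => x h /[dup] xab /h.
by rewrite patchE ifT// inE/= in_itv/=; case/andP: xab => /ltW -> /ltW ->.
Qed.

(** * Continuous and absolutely continuous functions on a compact interval *)

Lemma continuous_bounded_itv (R : realType) (f : R -> R) (a b : R) :
  continuous f -> exists2 M : R, 0 < M & forall x, a <= x <= b -> `|f x| <= M.
Proof.
move=> cf; have [ab|ba] := leP a b; last first.
  by exists 1 => // x /andP[ax xb]; have := le_trans ax xb; rewrite leNgt ba.
have [|c _ cM] := @EVT_max _ (fun x => `|f x|) a b ab.
  by apply: continuous_subspaceT => x; apply: cvg_norm; exact: cf.
exists (`|f c| + 1); first by rewrite ltr_wpDl.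
by move=> x xab; rewrite ler_wpDr// cM// in_itv.
Qed.

Lemma integrable_mul_continuous (R : realType) (q g : R -> R) (a b : R) :
  mu.-integrable `[a, b] (EFin \o q) -> continuous g ->
  mu.-integrable `[a, b] (EFin \o (fun x => q x * g x)).
Proof.
move=> intq cg; have [M M0 gM] := continuous_bounded_itv a b cg.
have mg : measurable_fun (`[a, b]%classic : set R) g.
  by apply: measurable_funTS; exact: continuous_measurable_fun.
have bg : [bounded g x | x in (`[a, b]%classic : set R)].
  exists M; split; first exact: num_real.
  by move=> N MN x /= xab; rewrite (le_trans (gM x _) (ltW MN))// -in_itv.
by have := integrableMl _ intq mg bg; apply; exact: measurable_itv.
Qed.

Lemma continuous_integrable_itv (R : realType) (g : R -> R) (a b : R) :
  continuous g -> mu.-integrable `[a, b] (EFin \o g).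
Proof.
move=> cg; apply: continuous_compact_integrable; first exact: segment_compact.
exact: continuous_subspaceT.
Qed.

(** Continuity on the whole line is carried along because the product rule [cont_acM] needs a bound
    for each factor on [[0, b]]. *)
Definition cont_ac (R : realType) (b : R) (F : R -> R) :=
  continuous F /\ abs_continuous 0 b F.

Lemma cont_acD (R : realType) (b : R) (F G : R -> R) : cont_ac b F -> cont_ac b G ->
  cont_ac b (fun x => F x + G x).
Proof.
move=> [cF aF] [cG aG]; split; first by move=> x; apply: cvgD; [exact: cF|exact: cG].
move=> e e0; have e20 : 0 < e / 2 by rewrite divr_gt0.
have [d1 d10 h1] := aF _ e20; have [d2 d20 h2] := aG _ e20.
exists (Num.min d1 d2); first by rewrite lt_min d10.
move=> n s t st tri; rewrite lt_min => /andP[/h1 l1 /h2 l2].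
rewrite [e]splitr; apply: le_lt_trans (ltrD (l1 st tri) (l2 st tri)).
rewrite -big_split/=; apply: ler_sum => i _.
by rewrite opprD addrACA ler_normD.
Qed.

Lemma cont_acM (R : realType) (b : R) (F G : R -> R) : cont_ac b F -> cont_ac b G ->
  cont_ac b (fun x => F x * G x).
Proof.
move=> [cF aF] [cG aG]; split; first by move=> x; apply: cvgM; [exact: cF|exact: cG].
have [M M0 FM] := continuous_bounded_itv 0 b cF.
have [N N0 GN] := continuous_bounded_itv 0 b cG.
move=> e e0.
have e1 : 0 < e / 2 / N by rewrite !divr_gt0.
have e2 : 0 < e / 2 / M by rewrite !divr_gt0.
have [d1 d10 h1] := aF _ e1; have [d2 d20 h2] := aG _ e2.
exists (Num.min d1 d2); first by rewrite lt_min d10.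
move=> n s t st tri; rewrite lt_min => /andP[/h1 l1 /h2 l2].
have {}l1 := l1 st tri; have {}l2 := l2 st tri.
rewrite ltr_pdivlMr// mulrC in l1; rewrite ltr_pdivlMr// mulrC in l2.
rewrite [e]splitr; apply: le_lt_trans (ltrD l1 l2).
rewrite !mulr_sumr -big_split/=; apply: ler_sum => i _.
have [/andP[si ti] tb] := st i.
have -> : F (t i) * G (t i) - F (s i) * G (s i) =
  G (t i) * (F (t i) - F (s i)) + F (s i) * (G (t i) - G (s i)) by ring.
rewrite (le_trans (ler_normD _ _))// !normrM lerD// ler_wpM2r//.
  by apply: GN; rewrite tb (le_trans si).
by apply: FM; rewrite si (le_trans ti).
Qed.

Lemma C1_abs_continuous (R : realType) (a b : R) (F F' : R -> R) :
  (forall x : R, is_derive x (1 : R) F (F' x)) -> continuous F' ->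
  continuous F /\ abs_continuous a b F.
Proof.
move=> dF cF'.
have cF : continuous F.
  by move=> x; apply: differentiable_continuous; apply/derivable1_diffP/ex_derive.
split => // e e0; have [M M0 FM] := continuous_bounded_itv a b cF'.
exists (e / M); first exact: divr_gt0.
move=> n s t st tri; rewrite ltr_pdivlMr// mulrC; apply: le_lt_trans.
rewrite mulr_sumr; apply: ler_sum => i _; have [/andP[si ti] tb] := st i.
move: ti; rewrite le_eqVlt => /predU1P[->|sti]; first by rewrite !subrr normr0 mulr0.
have [c cst ->] := MVT sti (fun x _ => dF x) (continuous_subspaceT cF).
rewrite normrM [X in _ * X <= _]gtr0_norm ?subr_gt0// ler_wpM2r// ?subr_ge0 ?(ltW sti)//.
move: cst; rewrite in_itv/= => /andP[sc ct].
by apply: FM; rewrite (le_trans si (ltW sc)) (le_trans (ltW ct)).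
Qed.

Lemma cont_ac_C1 (R : realType) (b : R) (F F' : R -> R) :
  (forall x : R, is_derive x (1 : R) F (F' x)) -> continuous F' -> cont_ac b F.
Proof. exact: C1_abs_continuous. Qed.

Lemma cont_ac_cst (R : realType) (b c : R) : cont_ac b (fun _ => c).
Proof.
by apply: (@cont_ac_C1 _ _ _ (fun _ => 0)) => x; exact: cvg_cst.
Qed.

Lemma cont_acB (R : realType) (b : R) (F G : R -> R) : cont_ac b F -> cont_ac b G ->
  cont_ac b (fun x => F x - G x).
Proof.
move=> aF aG; have := cont_acD aF (cont_acM (cont_ac_cst b (-1)) aG).
by rewrite (_ : (fun _ => _) = (fun x => F x - G x))//; apply/funext => x; rewrite mulN1r.
Qed.

(** * Schrodinger equation with real solutions *)

Section derivative_rules.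
Context {R : realType}.
Implicit Types (f g : R -> R) (x a b c d : R).

Lemma is_derive_mul f g x a b : is_derive x (1 : R) f a -> is_derive x (1 : R) g b ->
  is_derive x (1 : R) (fun y => f y * g y) (a * g x + f x * b).
Proof.
move=> df dg; have := @is_deriveM _ _ f g x 1 a b df dg.
by move=> h; apply: is_derive_eq; rewrite addrC mulrC [X in _ + X]mulrC.
Qed.

Lemma is_derive_add f g x a b : is_derive x (1 : R) f a -> is_derive x (1 : R) g b ->
  is_derive x (1 : R) (fun y => f y + g y) (a + b).
Proof. by move=> df dg; exact: is_deriveD. Qed.

Lemma is_derive_sub f g x a b : is_derive x (1 : R) f a -> is_derive x (1 : R) g b ->
  is_derive x (1 : R) (fun y => f y - g y) (a - b).
Proof. by move=> df dg; exact: is_deriveB. Qed.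

Lemma is_derive_affine x c d : is_derive x (1 : R) (fun y => c * y + d) c.
Proof.
have h : is_derive x (1 : R) (fun y => c * y + d) (0 * x + c * 1 + 0).
  by apply: is_derive_add; apply: is_derive_mul.
by apply: is_derive_eq; rewrite mul0r mulr1 addr0 add0r.
Qed.

Lemma is_derive_cos_affine x c d :
  is_derive x (1 : R) (fun y => cos (c * y + d)) (- c * sin (c * x + d)).
Proof.
have h := @is_derive1_comp R cos (fun y => c * y + d) x _ _
  (is_derive_cos _) (is_derive_affine x c d).
apply: is_derive_eq; rewrite /=; ring.
Qed.

Lemma is_derive_sin_affine x c d :
  is_derive x (1 : R) (fun y => sin (c * y + d)) (c * cos (c * x + d)).
Proof.
have h := @is_derive1_comp R sin (fun y => c * y + d) x _ _
  (is_derive_sin _) (is_derive_affine x c d).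
by apply: is_derive_eq; rewrite /=; ring.
Qed.

Lemma continuous_affine c d : continuous (fun y : R => c * y + d).
Proof.
move=> x; apply: cvgD; last exact: cvg_cst.
by apply: cvgM; [exact: cvg_cst|exact: cvg_id].
Qed.

Lemma continuous_cos_affine c d : continuous (fun y : R => cos (c * y + d)).
Proof.
move=> x; apply: (continuous_comp (@continuous_affine c d x)).
exact: continuous_cos.
Qed.

Lemma continuous_sin_affine c d : continuous (fun y : R => sin (c * y + d)).
Proof.
move=> x; apply: (continuous_comp (@continuous_affine c d x)).
exact: continuous_sin.
Qed.

Lemma cont_ac_cos_affine b c d : cont_ac b (fun y => cos (c * y + d)).
Proof.
apply: (@cont_ac_C1 _ _ _ (fun x => - c * sin (c * x + d))) => x.
  exact: is_derive_cos_affine.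
by apply: cvgM; [exact: cvg_cst|exact: continuous_sin_affine].
Qed.

Lemma cont_ac_sin_affine b c d : cont_ac b (fun y => sin (c * y + d)).
Proof.
apply: (@cont_ac_C1 _ _ _ (fun x => c * cos (c * x + d))) => x.
  exact: is_derive_sin_affine.
by apply: cvgM; [exact: cvg_cst|exact: continuous_cos_affine].
Qed.

End derivative_rules.

(** The derivative [v] is explicit data and u' = v holds on the whole line, so that the two-sided
    calculus of [is_derive] applies at 0 too. The differential equation is asked only for x > 0,
    which leaves room for any C^1 continuation to the left. *)
Record real_solution (R : realType) (q : R -> R) (k : R) (u v : R -> R) : Prop := {
  rs_derive : forall x : R, is_derive x (1 : R) u (v x) ;
  rs_acc : forall b : R, 0 < b -> cont_ac b v ;
  rs_eq : {ae @lebesgue_measure R, forall x : R, 0 < x ->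
    is_derive x (1 : R) v ((q x - k ^+ 2) * u x)} }.

Section real_solution_theory.
Context {R : realType}.
Implicit Types (q u v : R -> R) (k : R).

Lemma rs_continuous q k u v : real_solution q k u v -> continuous u.
Proof.
move=> [du _ _] x; apply: differentiable_continuous.
by apply/derivable1_diffP; apply: ex_derive.
Qed.

Lemma rs_continuous_deriv q k u v : real_solution q k u v -> continuous v.
Proof. by move=> [_ /(_ 1 ltr01)[]]. Qed.

Lemma rs_acc_fun q k u v b : real_solution q k u v -> cont_ac b u.
Proof.
move=> s; apply: (@cont_ac_C1 _ _ _ v); first exact: rs_derive s.
exact: rs_continuous_deriv s.
Qed.

Lemma rs_lin q k u1 v1 u2 v2 c1 c2 : real_solution q k u1 v1 -> real_solution q k u2 v2 ->
  real_solution q k (fun x => c1 * u1 x + c2 * u2 x) (fun x => c1 * v1 x + c2 * v2 x).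
Proof.
move=> [d1 a1 e1] [d2 a2 e2].
have lin (f g : R -> R) x a b : is_derive x (1 : R) f a -> is_derive x (1 : R) g b ->
    is_derive x (1 : R) (fun y => c1 * f y + c2 * g y) (c1 * a + c2 * b).
  move=> df dg.
  have h := is_derive_add (is_derive_mul (is_derive_cst c1 x 1) df)
                          (is_derive_mul (is_derive_cst c2 x 1) dg).
  by apply: is_derive_eq; rewrite !mul0r !add0r.
split.
- by move=> x; apply: lin.
- by move=> b b0; apply: cont_acD; apply: cont_acM; (try exact: cont_ac_cst); auto.
- apply: (ae_imply2 e1 e2) => x h1 h2 x0.
  have := lin _ _ _ _ _ (h1 x0) (h2 x0) => h.
  by apply: is_derive_eq; ring.
Qed.

(** The common k^2 cancels in the derivative of v1 u2 - u1 v2, leaving (q1 - q2) u1 u2. With q1 = q2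
    this is the constancy of the Wronskian. *)
Lemma wronskian_int q1 q2 k u1 v1 u2 v2 (b : R) : 0 <= b ->
  (forall b, mu.-integrable `[0, b] (EFin \o q1)) ->
  (forall b, mu.-integrable `[0, b] (EFin \o q2)) ->
  real_solution q1 k u1 v1 -> real_solution q2 k u2 v2 ->
  \int[mu]_(x in `[0, b]) ((q1 x - q2 x) * (u1 x * u2 x)) =
  (v1 b * u2 b - u1 b * v2 b) - (v1 0 * u2 0 - u1 0 * v2 0).
Proof.
move=> b0 i1 i2 s1 s2.
have [->|bn0] := eqVneq b 0; first by rewrite set_itv1 Rintegral_set1 subrr.
have bp : 0 < b by rewrite lt_neqAle eq_sym bn0.
have cu1 := rs_continuous s1; have cu2 := rs_continuous s2.
pose F x := v1 x * u2 x - u1 x * v2 x.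
have := @ac_FTC_itv R F (fun x => (q1 x - q2 x) * (u1 x * u2 x)) 0 b b0.
rewrite /F; apply.
- have : cont_ac b F.
    apply: cont_acB; apply: cont_acM; [exact: rs_acc s1 b bp|exact: rs_acc_fun s2|
      exact: rs_acc_fun s1|exact: rs_acc s2 b bp].
  by case.
- apply: integrable_mul_continuous; last first.
    by move=> x; apply: cvgM; [exact: cu1|exact: cu2].
  by have := integrableB _ (i1 b) (i2 b); apply; exact: measurable_itv.
- apply: (ae_imply2 (rs_eq s1) (rs_eq s2)) => x h1 h2 /andP[x0 _].
  have h := is_derive_sub (is_derive_mul (h1 x0) (rs_derive s2 x))
                          (is_derive_mul (rs_derive s1 x) (h2 x0)).
  by apply: is_derive_eq; ring.
Qed.

(** Variation of constants: u(y) cos(k(x-y)) + v(y) sin(k(x-y)) / k goes from cos(kx) at y = 0 to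
    u(x) at y = x, and its derivative in y is q(y) u(y) sin(k(x-y)) / k. *)
Lemma duhamel q k u v (x : R) : 0 < k -> 0 <= x ->
  (forall b, mu.-integrable `[0, b] (EFin \o q)) ->
  real_solution q k u v -> u 0 = 1 -> v 0 = 0 ->
  u x = cos (k * x) + \int[mu]_(y in `[0, x]) (q y * (u y * (sin (k * (x - y)) / k))).
Proof.
move=> k0 x0 iq s u0 v0.
have [->|xn0] := eqVneq x 0.
  by rewrite set_itv1 Rintegral_set1 addr0 mulr0 cos0.
have xp : 0 < x by rewrite lt_neqAle eq_sym xn0.
have kE y : k * (x - y) = - k * y + k * x by ring.
pose F y := u y * cos (- k * y + k * x) + v y * (sin (- k * y + k * x) * k^-1).
have := @ac_FTC_itv R F (fun y => q y * (u y * (sin (k * (x - y)) / k))) 0 x x0.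
move=> -> //.
- rewrite /F mulr0 add0r mulNr addNr sin0 cos0 u0 v0; ring.
- have : cont_ac x F.
    apply: cont_acD; apply: cont_acM; [exact: rs_acc_fun s|exact: cont_ac_cos_affine|
      exact: rs_acc s x xp|].
    by apply: cont_acM; [exact: cont_ac_sin_affine|exact: cont_ac_cst].
  by case.
- apply: integrable_mul_continuous => // y.
  apply: cvgM; first exact: (rs_continuous s).
  apply: cvgM; last exact: cvg_cst.
  under eq_fun do rewrite kE.
  by rewrite kE; exact: continuous_sin_affine.
- apply: (ae_imply (rs_eq s)) => y h /andP[y0 _].
  have d2 := is_derive_mul (h y0) (is_derive_mul (is_derive_sin_affine y (- k) (k * x))
    (is_derive_cst k^-1 y 1)).
  have h' := is_derive_add (is_derive_mul (rs_derive s y)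
    (is_derive_cos_affine y (- k) (k * x))) d2.
  apply: is_derive_eq; rewrite kE /=. by field; rewrite gt_eqF.
Qed.
End real_solution_theory.

(** * From one-sided derivatives to solutions on the whole line *)

Section half_line.
Context {R : realType}.
Implicit Types (f u v : R -> R) (x l : R).

Lemma is_derive_eps f x l :
  (forall e, 0 < e -> exists2 r : R, 0 < r & forall h : R, `|h| < r -> h != 0 ->
     `|l - (f (x + h) - f x) / h| <= e) ->
  is_derive x (1 : R) f l.
Proof.
move=> H.
have cv : h^-1 *: ((f \o shift x) (h *: (1 : R)) - f x) @[h --> 0^'] --> l.
  apply/cvgrPdist_le => e /H[r r0 hr]; exists r => //= h.
  rewrite /= sub0r normrN => hr' h0; have := hr h hr' h0.
  by rewrite /= [h%:A]mulr1 [_ *: _]mulrC [h + x]addrC.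
by apply: DeriveDef; [apply/cvg_ex; exists l|apply/cvg_lim].
Qed.

Lemma half_derive_eps u x : half_derivable u x -> forall e, 0 < e ->
  exists2 r : R, 0 < r & forall h : R, `|h| < r -> h != 0 -> 0 <= x + h ->
     `|half_derive u x - (u (x + h) - u x) / h| <= e.
Proof.
move=> cu e e0; move/cvgrPdist_le : (cu) => /(_ _ e0)[r /= r0 hr].
exists r => // h hr' h0 xh; apply: hr => //=.
by rewrite sub0r normrN.
Qed.

(* The affine continuation to the negative half-line makes the solution
   differentiable on the whole line. *)
Lemma real_solution_half_line q k u :
  (forall x, 0 <= x -> half_derivable u x) ->
  (forall b, 0 < b -> abs_continuous 0 b (half_derive u)) ->
  {ae @lebesgue_measure R, forall x : R, 0 < x ->
    half_derivable (half_derive u) x /\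
    half_derive (half_derive u) x = (q x - k ^+ 2) * u x} ->
  real_solution q k (fun x => if 0 <= x then u x else u 0 + half_derive u 0 * x)
    (fun x => half_derive u (Num.max 0 x)).
Proof.
move=> du av aeq; set v := half_derive u; set U := fun x => _.
have maxE (x : R) : 0 <= x -> Num.max 0 x = x by move=> x0; rewrite max_r.
have acv (b : R) : 0 < b -> cont_ac b (fun x => v (Num.max 0 x)).
  move=> b0; split.
    move=> x; apply/cvgrPdist_lt => e e0.
    have X0 : 0 < `|x| + 1 by rewrite ltr_wpDl.
    have [d d0 hd] := av _ X0 _ e0.
    (* A family of one interval turns absolute continuity into uniform continuity. *)
    have key (s t : R) : 0 <= s -> s <= t -> t <= `|x| + 1 -> t - s < d -> `|v t - v s| < e.
      move=> s0 st tx ts; have := hd 1%N (fun _ => s) (fun _ => t).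
      rewrite !big_ord1; apply => //; first by move=> _; rewrite s0 st.
      by move=> i j; rewrite (ord1 i) (ord1 j).
    exists (Num.min d 1) => [|y /=]; first by rewrite /= lt_min d0 ltr01.
    rewrite lt_min => /andP[yx y1].
    have mx (z : R) : 0 <= Num.max 0 z by rewrite le_max lexx.
    have mxd : `|Num.max 0 x - Num.max 0 y| <= `|x - y|.
      rewrite /Num.max; case: ltP => x0; case: ltP => y0 //.
      - by rewrite subr0 !gtr0_norm ?subr_gt0//; lra.
      - by rewrite sub0r normrN gtr0_norm// ler0_norm ?subr_le0; lra.
      - by rewrite subrr normr0.
    have m1 : Num.max 0 x <= `|x| + 1.
      by rewrite ge_max (ltW X0) ler_wpDr// ler_norm.
    have m2 : Num.max 0 y <= `|x| + 1.
      rewrite ge_max (ltW X0) /=; have := ler_norm x; have := ler_norm (y - x).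
      by rewrite distrC; lra.
    have [xy|yx'] := leP (Num.max 0 x) (Num.max 0 y).
      rewrite distrC; apply: key => //.
      by rewrite -[ltLHS]ger0_norm ?subr_ge0// distrC (le_lt_trans mxd).
    apply: key => //; first exact: ltW.
    by rewrite -[ltLHS]gtr0_norm ?subr_gt0// (le_lt_trans mxd).
  move=> e e0; have [d d0 hd] := av b b0 e e0.
  exists d => // n s t st tri std.
  rewrite (eq_bigr (fun i => `|v (t i) - v (s i)|)); first exact: hd.
  move=> i _; have [/andP[s0 st'] _] := st i.
  by rewrite !maxE// (le_trans s0).
split => //.
- move=> x; apply: is_derive_eps => e e0 /=.
  have [x0|x0|x0] := ltgtP x 0.
  - exists (- x) => [|h]; first by rewrite oppr_gt0.
    rewrite ltr_norml opprK => /andP[_ hx] h0.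
    have xh : (0 <= x + h) = false by apply/negbTE; rewrite -ltNge; lra.
    have xx : (0 <= x) = false by apply/negbTE; rewrite -ltNge.
    rewrite /U xh xx.
    rewrite (_ : v 0 - _ = 0) ?normr0 ?(ltW e0)//.
    by rewrite -/v; field.
  - have [r r0 hr] := half_derive_eps (du x (ltW x0)) e0.
    exists (Num.min r x) => [|h]; first by rewrite lt_min r0.
    rewrite lt_min => /andP[hr' hx] h0.
    have xh0 : 0 <= x + h by move: hx; rewrite ltr_norml => /andP[]; lra.
    by rewrite /U (ltW x0) xh0; exact: hr.
  - have [r r0 hr] := half_derive_eps (du 0 (lexx _)) e0.
    exists r => // h hlt hn0; rewrite x0 /U lexx.
    case: ifPn => xh; first exact: hr.
    rewrite add0r -/v (_ : v 0 - _ = 0) ?normr0 ?(ltW e0)//.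
    by field.
- apply: (ae_imply aeq) => x h x0; have [h1 h2] := h x0.
  rewrite /U (ltW x0) -h2; apply: is_derive_eps => e e0 /=.
  have [r r0 hr] := half_derive_eps h1 e0.
  exists (Num.min r x) => [|y]; first by rewrite lt_min r0.
  rewrite lt_min => /andP[yr yx] y0.
  have xy0 : 0 <= x + y by move: yx; rewrite ltr_norml => /andP[]; lra.
  by rewrite !maxE ?(ltW x0)//; exact: hr.
Qed.
End half_line.

(** * Behaviour beyond the support, and the regular solution *)

Section free_solution.
Context {R : realType}.
Implicit Types (q u v : R -> R) (k a : R).

(** A shift by a quarter period pi / (2k) rotates (cos, sin), so the squares of the two values at x
    and at the shifted point add up to C^2 + D^2, while both values are small. *)
Lemma trig_asymptotics_unique (k C D : R) : 0 < k ->
  (fun x : R => C * cos (k * x) + D * sin (k * x)) x @[x --> +oo] --> (0 : R) ->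
  C = 0 /\ D = 0.
Proof.
move=> k0 /cvgrPdist_lt hlim.
suff : C ^+ 2 + D ^+ 2 <= 0.
  have C2 := sqr_ge0 C; have D2 := sqr_ge0 D => S.
  by split; apply/eqP; rewrite -sqrf_eq0 eq_le; apply/andP; split; lra.
apply/ler_addgt0Pr => e e0; rewrite add0r.
(* With |y| below both 1 and e / 2, the square of y is at most e / 2. *)
pose d := Num.min 1 (e / 2).
have d0 : 0 < d by rewrite lt_min ltr01 divr_gt0.
have [M [_ hM]] := hlim _ d0.
pose x := M + 1.
have Mx : M < x by rewrite ltrDl.
have pk : 0 < pi / 2 / k by rewrite !divr_gt0 ?pi_gt0.
have Mx' : M < x + pi / 2 / k by rewrite (lt_trans Mx)// ltrDl.
have h1 := hM _ Mx; have h2 := hM _ Mx'; rewrite /= !sub0r !normrN in h1 h2.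
have kE : k * (x + pi / 2 / k) = k * x + pi / 2 by field; rewrite gt_eqF.
rewrite kE cosDpihalf sinDpihalf in h2.
set c := cos (k * x) in h1 h2; set s := sin (k * x) in h1 h2.
have cs : c ^+ 2 + s ^+ 2 = 1 by exact: cos2Dsin2.
have -> : C ^+ 2 + D ^+ 2 = (C * c + D * s) ^+ 2 + (C * - s + D * c) ^+ 2.
  transitivity ((C ^+ 2 + D ^+ 2) * (c ^+ 2 + s ^+ 2)); first by rewrite cs mulr1.
  by ring.
have sq (y : R) : `|y| < d -> y ^+ 2 <= e / 2.
  move=> yd; rewrite -real_normK ?num_real//.
  have y1 : `|y| <= 1 by apply: ltW (lt_le_trans yd _); rewrite ge_min lexx.
  have y2 : `|y| <= e / 2 by apply: ltW (lt_le_trans yd _); rewrite ge_min lexx orbT.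
  by rewrite expr2 (le_trans _ y2)// ler_piMr.
by have := sq _ h1; have := sq _ h2; lra.
Qed.

(** The amplitudes [al] and [be] of u = al cos + be sin, v = k (be cos - al sin) have derivative
    zero almost everywhere beyond a, hence are constant there. The asymptotics of u alone identify
    both amplitudes, and v follows. *)
Lemma free_beyond_support q k u v a A B : 0 < k -> 0 < a ->
  {ae @lebesgue_measure R, forall x : R, a < x -> q x = 0} ->
  real_solution q k u v ->
  (fun x => u x - (A * cos (k * x) + B * sin (k * x))) x @[x --> +oo] --> (0 : R) ->
  forall x, a <= x -> u x = A * cos (k * x) + B * sin (k * x) /\
                      v x = k * (B * cos (k * x) - A * sin (k * x)).
Proof.
move=> k0 a0 qa s ulim.
have kn0 : k != 0 by rewrite gt_eqF.
pose al x := u x * cos (k * x + 0) - v x * (sin (k * x + 0) * k^-1).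
pose be x := u x * sin (k * x + 0) + v x * (cos (k * x + 0) * k^-1).
have cst (F : R -> R) : (forall b : R, 0 < b -> cont_ac b F) ->
    {ae @lebesgue_measure R, forall x : R, a < x -> is_derive x (1 : R) F 0} ->
    forall x, a <= x -> F x = F a.
  move=> aF dF x ax.
  have := @ac_FTC_itv R F (fun=> 0) a x ax.
  rewrite Rintegral_cst// mul0r => H; apply/eqP; rewrite -subr_eq0; apply/eqP/esym/H.
  - have [_ acF] := aF x (lt_le_trans a0 ax).
    move=> e e0; have [d d0 hd] := acF e e0; exists d => // n st t sth.
    by apply: hd => i; have [/andP[si ->] ->] := sth i; rewrite (le_trans (ltW a0) si).
  - by apply: continuous_integrable_itv => y; exact: cvg_cst.
  - by apply: (ae_imply dF) => y h /andP[ay _]; exact: h.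
have su b := rs_acc_fun b s; have sv := rs_acc s.
have dal : forall x, a <= x -> al x = al a.
  apply: cst => [b b0|].
    apply: cont_acB; apply: cont_acM; [exact: su|exact: cont_ac_cos_affine|exact: sv|].
    by apply: cont_acM; [exact: cont_ac_sin_affine|exact: cont_ac_cst].
  apply: (ae_imply2 qa (rs_eq s)) => x qx dv ax.
  have dv0 := dv (lt_trans a0 ax); rewrite qx// in dv0.
  have h := is_derive_sub (is_derive_mul (rs_derive s x) (is_derive_cos_affine x k 0))
    (is_derive_mul dv0 (is_derive_mul (is_derive_sin_affine x k 0) (is_derive_cst k^-1 x 1))).
  by apply: is_derive_eq; rewrite /=; field.
have dbe : forall x, a <= x -> be x = be a.
  apply: cst => [b b0|].
    apply: cont_acD; apply: cont_acM; [exact: su|exact: cont_ac_sin_affine|exact: sv|].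
    by apply: cont_acM; [exact: cont_ac_cos_affine|exact: cont_ac_cst].
  apply: (ae_imply2 qa (rs_eq s)) => x qx dv ax.
  have dv0 := dv (lt_trans a0 ax); rewrite qx// in dv0.
  have h := is_derive_add (is_derive_mul (rs_derive s x) (is_derive_sin_affine x k 0))
    (is_derive_mul dv0 (is_derive_mul (is_derive_cos_affine x k 0) (is_derive_cst k^-1 x 1))).
  by apply: is_derive_eq; rewrite /=; field.
have cs x : cos (k * x) ^+ 2 = 1 - sin (k * x) ^+ 2 by rewrite sin2cos2; ring.
have uE x : a <= x -> u x = al a * cos (k * x) + be a * sin (k * x).
  move=> ax; rewrite -(dal x ax) -(dbe x ax) /al /be addr0.
  transitivity (u x * (cos (k * x) ^+ 2 + sin (k * x) ^+ 2)); last by field.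
  by rewrite cs subrK mulr1.
have vE x : a <= x -> v x = k * (be a * cos (k * x) - al a * sin (k * x)).
  move=> ax; rewrite -(dal x ax) -(dbe x ax) /al /be addr0.
  transitivity (v x * (cos (k * x) ^+ 2 + sin (k * x) ^+ 2)); last by field.
  by rewrite cs subrK mulr1.
have [|CA DB] := @trig_asymptotics_unique k (al a - A) (be a - B) k0.
  apply: cvg_trans ulim; apply: near_eq_cvg; near=> x.
  rewrite uE; first by rewrite /=; ring.
  by near: x; apply: nbhs_pinfty_ge; exact: num_real.
move/eqP : CA; rewrite subr_eq0 => /eqP CA.
move/eqP : DB; rewrite subr_eq0 => /eqP DB.
by move=> x ax; rewrite -CA -DB; split; [exact: uE|exact: vE].
Unshelve. all: by end_near. Qed.

Lemma normc_ge_parts (z : R[i]) :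
  `|complex.Re z| <= Normc.normc z /\ `|complex.Im z| <= Normc.normc z.
Proof.
case: z => x y /=; rewrite -!sqrtr_sqr !ler_sqrt ?addr_ge0 ?sqr_ge0//.
by rewrite lerDl lerDr !sqr_ge0.
Qed.

Lemma jost_regular_solution q k (f : R -> R[i]) a : 0 < k -> 0 < a ->
  (forall b, mu.-integrable `[0, b] (EFin \o q)) ->
  {ae @lebesgue_measure R, forall x : R, a < x -> q x = 0} ->
  jost_solution q k f ->
  exists u v : R -> R, [/\ real_solution q k u v, u 0 = 1, v 0 = 0 &
    forall x, a <= x ->
      u x = (complex.Im (cderive f 0) * cos (k * x) -
             complex.Re (cderive f 0) * sin (k * x)) / k /\
      v x = - (complex.Im (cderive f 0) * sin (k * x) +
               complex.Re (cderive f 0) * cos (k * x))].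
Proof.
move=> k0 a0 iq qa [[sd sa se] lim].
have kn0 : k != 0 by rewrite gt_eqF.
pose f1 t := complex.Re (f t); pose f2 t := complex.Im (f t).
have s1 : real_solution q k (fun x => if 0 <= x then f1 x else f1 0 + half_derive f1 0 * x)
    (fun x => half_derive f1 (Num.max 0 x)).
  apply: real_solution_half_line.
  - by move=> x /sd[].
  - by move=> b /sa[].
  - apply: (ae_imply se) => x h /h[[h1 _]] /(congr1 (@complex.Re R)).
    rewrite /f1; case: (f x) => c d /= E; split => //; apply/eqP.
    rewrite -subr_eq0; apply/eqP; rewrite -{}[RHS]E; ring.
have s2 : real_solution q k (fun x => if 0 <= x then f2 x else f2 0 + half_derive f2 0 * x)
    (fun x => half_derive f2 (Num.max 0 x)).
  apply: real_solution_half_line.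
  - by move=> x /sd[].
  - by move=> b /sa[].
  - apply: (ae_imply se) => x h /h[[_ h1]] /(congr1 (@complex.Im R)).
    rewrite /f2; case: (f x) => c d /= E; split => //; apply/eqP.
    rewrite -subr_eq0; apply/eqP; rewrite -{}[RHS]E; ring.
have lim' (g h : R -> R) : (forall x, 0 <= x -> `|g x - h x| <=
      Normc.normc (f x - (cos (k * x) +i* sin (k * x))%C)) ->
    (g x - h x) @[x --> +oo] --> (0 : R).
  move=> gh; apply/cvgrPdist_lt => e e0; move/cvgrPdist_lt : (lim) => /(_ e e0) hlim.
  near=> x; rewrite sub0r normrN.
  have x0 : 0 <= x by near: x; apply: nbhs_pinfty_ge; exact: num_real.
  apply: le_lt_trans (gh x x0) _; apply: le_lt_trans (ler_norm _) _.
  by rewrite -normrN -sub0r; near: x.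
set U1 := (fun x => _) in s1; set V1 := (fun x => _) in s1.
set U2 := (fun x => _) in s2; set V2 := (fun x => _) in s2.
have e1 : forall x, a <= x -> U1 x = 1 * cos (k * x) + 0 * sin (k * x) /\
    V1 x = k * (0 * cos (k * x) - 1 * sin (k * x)).
  apply: (free_beyond_support k0 a0 qa s1); apply: lim' => x x0.
  rewrite /U1 x0 mul1r mul0r addr0.
  apply: le_trans (normc_ge_parts _).1.
  by rewrite /f1; case: (f x).
have e2 : forall x, a <= x -> U2 x = 0 * cos (k * x) + 1 * sin (k * x) /\
    V2 x = k * (1 * cos (k * x) - 0 * sin (k * x)).
  apply: (free_beyond_support k0 a0 qa s2); apply: lim' => x x0.
  rewrite /U2 x0 mul1r mul0r add0r.
  apply: le_trans (normc_ge_parts _).2.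
  by rewrite /f2; case: (f x).
set P := cderive f 0.
have P1 : complex.Re P = V1 0 by rewrite /V1 maxxx.
have P2 : complex.Im P = V2 0 by rewrite /V2 maxxx.
have W := wronskian_int (ltW a0) iq iq s1 s2.
have [Ua1 Va1] := e1 a (lexx a); have [Ua2 Va2] := e2 a (lexx a).
(* The Wronskian identity for a single potential: the Wronskian at 0 equals the one at a, where both
   solutions are explicit. *)
have I0 : \int[mu]_(x in `[0, a]) ((q x - q x) * (U1 x * U2 x)) = 0.
  by under eq_Rintegral do rewrite subrr mul0r; rewrite Rintegral_cst// mul0r.
rewrite I0 Ua1 Ua2 Va1 Va2 in W.
have cs : cos (k * a) ^+ 2 = 1 - sin (k * a) ^+ 2 by rewrite sin2cos2; ring.
have W0 : V2 0 * U1 0 - V1 0 * U2 0 = k.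
  transitivity (k * (cos (k * a) ^+ 2 + sin (k * a) ^+ 2)); last by rewrite cs subrK mulr1.
  apply/eqP; rewrite -subr_eq0; apply/eqP; rewrite [RHS]W; ring.
exists (fun x => (V2 0 / k) * U1 x + (- V1 0 / k) * U2 x).
exists (fun x => (V2 0 / k) * V1 x + (- V1 0 / k) * V2 x).
split.
- exact: rs_lin.
- by apply: (mulIf kn0); rewrite mul1r -[RHS]W0; field.
- by field.
- move=> x /[dup] /e1[-> ->] /e2[-> ->]; rewrite P1 P2.
  by split; field.
Unshelve. all: by end_near. Qed.
End free_solution.

(** * Wave equation estimate *)

Section interval_integrals.
Context {R : realType}.
Implicit Types (f g : R -> R) (a b c d : R).

Lemma Rintegral_affine g a b c d : 0 < c -> a <= b -> continuous g ->
  \int[mu]_(x in `[c * a + d, c * b + d]) g x = c * \int[mu]_(x in `[a, b]) g (c * x + d).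
Proof.
move=> c0 ab cg.
have cgF : continuous (fun x => g (c * x + d)).
  by move=> x; apply: (continuous_comp (@continuous_affine R c d x)); exact: cg.
have F' : (fun x : R => c * x + d)^`()%classic = (fun=> c).
  apply/funext => x; rewrite derive1E.
  exact: (@derive_val _ _ _ _ _ _ _ (is_derive_affine x c d)).
rewrite -RintegralZl//; last exact: continuous_integrable_itv.
rewrite /Rintegral (integration_by_substitution_increasing ab (F := fun x => c * x + d)).
- congr fine; apply: eq_integral => x _.
  by rewrite F' /= [RHS]EFinM muleC.
- by move=> x y _ _ xy; rewrite ltrD2r ltr_pM2l.
- by rewrite F' => x _; exact: cvg_cst.
- by rewrite F'; exact: is_cvg_cst.
- by rewrite F'; exact: is_cvg_cst.
- split.
  + by move=> x _; exact: (@ex_derive _ _ _ _ _ _ _ (is_derive_affine x c d)).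
  + by apply: cvg_at_right_filter; exact: continuous_affine.
  + by apply: cvg_at_left_filter; exact: continuous_affine.
- exact: continuous_subspaceT.
Qed.

Lemma le_Rintegral_continuous f g a b : continuous f -> continuous g ->
  (forall x, a <= x <= b -> f x <= g x) ->
  \int[mu]_(x in `[a, b]) f x <= \int[mu]_(x in `[a, b]) g x.
Proof.
move=> cf cg fg; apply: le_Rintegral => //; exact: continuous_integrable_itv.
Qed.

Lemma le_norm_Rintegral_continuous f a b : continuous f ->
  `|\int[mu]_(x in `[a, b]) f x| <= \int[mu]_(x in `[a, b]) `|f x|.
Proof. by move=> cf; apply: le_normr_Rintegral => //; exact: continuous_integrable_itv. Qed.

Lemma continuous_normr f : continuous f -> continuous (fun x => `|f x|).
Proof. by move=> cf x; apply: cvg_norm; exact: cf. Qed.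

Lemma le_Rintegral_itv_subset f a b c d : continuous f -> (forall x, 0 <= f x) ->
  c <= a -> b <= d ->
  \int[mu]_(x in `[a, b]) f x <= \int[mu]_(x in `[c, d]) f x.
Proof.
move=> cf f0 ca bd; apply: le_Rintegral_subset => //.
- by move=> x /=; rewrite !in_itv/= => /andP[ax xb]; rewrite (le_trans ca) ?(le_trans xb).
- exact: continuous_integrable_itv.
Qed.

Lemma Rintegral_itv_cst a b c : a <= b -> \int[mu]_(x in `[a, b]) c = c * (b - a).
Proof.
move=> ab; rewrite Rintegral_cst//= lebesgue_measure_itv/= lte_fin.
by move: ab; rewrite le_eqVlt => /predU1P[->|ab]; [rewrite ltxx subrr|rewrite ab].
Qed.

Lemma continuous_bigsum n (f : 'I_n -> R -> R) : (forall i, continuous (f i)) ->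
  continuous (fun x => \sum_i f i x).
Proof.
elim: n f => [|n IHn] f cf.
  rewrite (_ : (fun x => _) = (fun=> 0)); last by apply/funext => x; rewrite big_ord0.
  by move=> x; exact: cvg_cst.
rewrite (_ : (fun x => _) =
    (fun x => f ord0 x + \sum_i f (lift ord0 i) x)); last first.
  by apply/funext => x; rewrite big_ord_recl.
move=> x; apply: cvgD; first exact: cf.
by apply: IHn => i; exact: cf.
Qed.

Lemma Rintegral_bigsum disp (T : measurableType disp) (m : {measure set T -> \bar R})
    (D : set T) (mD : measurable D) n (f : 'I_n -> T -> R) :
  (forall i, m.-integrable D (EFin \o f i)) ->
  m.-integrable D (EFin \o (fun x => \sum_i f i x)) /\
  \int[m]_(x in D) (\sum_i f i x) = \sum_i \int[m]_(x in D) f i x.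
Proof.
elim: n f => [|n IHn] f fi.
  rewrite big_ord0 (_ : (fun x => _) = (fun=> 0)); last first.
    by apply/funext => x; rewrite big_ord0.
  by rewrite /Rintegral integral0; split => //; exact: integrable0.
have [i1 e1] := IHn (fun i => f (lift ord0 i)) (fun i => fi _).
rewrite big_ord_recl -e1 (_ : (fun x => _) =
    (fun x => f ord0 x + \sum_i f (lift ord0 i) x)); last first.
  by apply/funext => x; rewrite big_ord_recl.
split; last by rewrite RintegralD.
by have := integrableD mD (fi ord0) i1.
Qed.

Lemma Rintegral_cos a b k : a <= b -> k != 0 ->
  \int[mu]_(x in `[a, b]) cos (k * x) = (sin (k * b) - sin (k * a)) / k.
Proof.
move=> ab k0.
have dF x : is_derive x (1 : R) (fun y => sin (k * y + 0) * k^-1) (cos (k * x)).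
  have h := is_derive_mul (is_derive_sin_affine x k 0) (is_derive_cst k^-1 x 1).
  by apply: is_derive_eq; rewrite /= addr0; field.
have cc : continuous (fun x => cos (k * x)).
  have := @continuous_cos_affine R k 0.
  by rewrite (_ : (fun y => _) = (fun x => cos (k * x)))//; apply/funext => y; rewrite addr0.
rewrite (@ac_FTC_itv R (fun y => sin (k * y + 0) * k^-1) (fun x => cos (k * x)))//.
- by rewrite !addr0 mulrBl.
- exact: (C1_abs_continuous a b dF cc).2.
- exact: continuous_integrable_itv.
- by apply: aeW => x _; exact: dF.
Qed.
End interval_integrals.

(** * D'Alembert's formula and Gronwall's lemma for cosine sums *)

Section wave_equation.
Context {R : realType}.
Implicit Types (q f g : R -> R) (a b x y s t : R).

(** It serves both as the boundary datum theta and, with coefficients [c i * phi i x], as the wave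
    U(x,.) itself. This is what allows a wave for q1 to become the datum of a wave for q2. *)
Definition cosine_sum n (c k : 'I_n -> R) (s : R) : R :=
  \sum_i c i * cos (k i * s).

(** Only the integral equation is kept. The wave equation is never differentiated, as U has no
    classical second derivative in x when q is merely integrable. *)
Definition duhamel_solution q (a k : R) (phi : R -> R) : Prop :=
  continuous phi /\ forall x : R, 0 <= x <= a ->
    phi x = cos (k * x) + \int[mu]_(y in `[0, x]) (q y * (phi y * (sin (k * (x - y)) / k))).

Lemma continuous_cosM (k : R) : continuous (fun x : R => cos (k * x)).
Proof.
have := @continuous_cos_affine R k 0.
by rewrite (_ : (fun y => _) = (fun x => cos (k * x)))//; apply/funext => y; rewrite addr0.
Qed.

Lemma continuous_cosine_sum n (c k : 'I_n -> R) : continuous (cosine_sum c k).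
Proof.
apply: continuous_bigsum => i x; apply: cvgM; first exact: cvg_cst.
exact: continuous_cosM.
Qed.

(** Integrating cos(ks) over an interval centred at t produces the kernel sin(kd) / k of Duhamel's
    formula. This turns the formulas for the single frequencies into one d'Alembert formula. *)
Lemma Rintegral_cosine_sum n (c k : 'I_n -> R) t d : 0 <= d -> (forall i, 0 < k i) ->
  \int[mu]_(s in `[t - d, t + d]) cosine_sum c k s =
  \sum_i c i * (2 * cos (k i * t) * (sin (k i * d) / k i)).
Proof.
move=> d0 k0.
have td : t - d <= t + d by lra.
rewrite (Rintegral_bigsum _ _).2//; last first.
  move=> i; apply: continuous_integrable_itv => x.
  by apply: cvgM; [exact: cvg_cst|exact: continuous_cosM].
apply: eq_bigr => i _; rewrite RintegralZl//; last first.
  by apply: continuous_integrable_itv; exact: continuous_cosM.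
rewrite Rintegral_cos ?gt_eqF//.
rewrite mulrDr mulrBr sinD sinB; field; rewrite gt_eqF//.
Qed.

(** The two levels are used twice: in Gronwall's argument B is a bound already known and M the one
    being proved; in the final estimate B is almost zero and M almost the length of an interval. *)
Lemma norm_Rintegral_mul_le (q g : R -> R) (x0 x B M : R) :
  (@lebesgue_measure R).-integrable setT (EFin \o q) -> continuous g -> 0 <= x0 <= x ->
  (forall y, 0 <= y <= x0 -> `|g y| <= B) -> (forall y, x0 <= y <= x -> `|g y| <= M) ->
  `|\int[mu]_(y in `[0, x]) (q y * g y)| <=
  B * \int[mu]_(y in `[0, x0]) `|q y| + M * \int[mu]_(y in `[x0, x]) `|q y|.
Proof.
move=> iq cg /andP[x00 x0x] gB gM.
have iqi (u v : R) : mu.-integrable `[u, v] (EFin \o q) by exact: integrableS iq.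
have iqn (u v : R) : mu.-integrable `[u, v] (EFin \o (fun z => `|q z|)).
  exact: integrable_norm (iqi u v).
have piece (u v K : R) : (forall y, u <= y <= v -> `|g y| <= K) ->
    `|\int[mu]_(y in `[u, v]) (q y * g y)| <= K * \int[mu]_(y in `[u, v]) `|q y|.
  move=> gK; apply: le_trans (le_normr_Rintegral _ _) _ => //.
    exact: integrable_mul_continuous.
  rewrite -RintegralZl//; apply: le_Rintegral => //.
  - have := integrable_norm (integrable_mul_continuous (iqi u v) cg).
    exact.
  - have cK : continuous (fun _ : R => K) by move=> z; exact: cvg_cst.
    have := integrable_mul_continuous (iqn u v) cK.
    by apply: eq_integrable => // y _ /=; rewrite mulrC.
  - by move=> y /=; rewrite in_itv/= => /gK h; rewrite normrM mulrC ler_wpM2r.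
have E := @Rintegral_itvB R (fun y => q y * g y) (BLeft 0) (BRight x) x0.
have := E; rewrite Rintegral_itv_obnd_cbnd; last first.
  by apply: integrableS (integrable_mul_continuous (iqi x0 x) cg) => //; exact: subset_itv_oc_cc.
rewrite !bnd_simp => /(_ (integrable_mul_continuous (iqi _ _) cg) x00 x0x) => {}E.
have -> : \int[mu]_(y in `[0, x]) (q y * g y) =
  \int[mu]_(y in `[0, x0]) (q y * g y) + \int[mu]_(y in `[x0, x]) (q y * g y).
  by rewrite -E addrC subrK.
by apply: le_trans (ler_normD _ _) _; apply: lerD; apply: piece.
Qed.

Section wave_bound.
Context (q : R -> R) (a : R) (n : nat) (c k : 'I_n -> R) (phi : 'I_n -> R -> R)
  (iq : (@lebesgue_measure R).-integrable setT (EFin \o q))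
  (k0 : forall i, 0 < k i)
  (phiP : forall i, duhamel_solution q a (k i) (phi i)).

Let U y := cosine_sum (fun i => c i * phi i y) k.
Let theta := cosine_sum c k.

(** For y <= x this is, by [Rintegral_cosine_sum], the integral of U(y,.) over [t-(x-y), t+(x-y)],
    the section at depth y of the characteristic triangle with apex (x,t). *)
Let G x t y : R :=
  \sum_i (c i * phi i y) * (2 * cos (k i * t) * (sin (k i * (x - y)) / k i)).

Let cphi i : continuous (phi i). Proof. by have [] := phiP i. Qed.

Let iqi (x y : R) : mu.-integrable `[x, y] (EFin \o q).
Proof. exact: integrableS iq. Qed.

Let iqn (x y : R) : mu.-integrable `[x, y] (EFin \o (fun z => `|q z|)).
Proof. exact: integrable_norm (iqi x y). Qed.

Let cterm x (i : 'I_n) : continuous (fun y => phi i y * (sin (k i * (x - y)) / k i)).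
Proof.
move=> y; apply: cvgM; first exact: cphi.
apply: cvgM; last exact: cvg_cst.
have kE z : k i * (x - z) = - k i * z + k i * x by ring.
under eq_fun do rewrite kE.
by rewrite kE; exact: continuous_sin_affine.
Qed.

Let GE x t y : G x t y =
  \sum_i (c i * (2 * cos (k i * t))) * (phi i y * (sin (k i * (x - y)) / k i)).
Proof. by apply: eq_bigr => i _; ring. Qed.

Let cG x t : continuous (G x t).
Proof.
have -> : G x t = fun y => \sum_i (c i * (2 * cos (k i * t))) *
    (phi i y * (sin (k i * (x - y)) / k i)) by apply/funext => y; exact: GE.
by apply: continuous_bigsum => i y; apply: cvgM; [exact: cvg_cst|exact: cterm].
Qed.

(** Each Duhamel equation is multiplied by c_i cos(k_i t) and summed; the product cos(k_i t) cos(k_i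
    x) splits into the two travelling waves. *)
Let wave_rep x t : 0 <= x <= a ->
  U x t = (theta (t + x) + theta (t - x)) / 2 +
          (\int[mu]_(y in `[0, x]) (q y * G x t y)) / 2.
Proof.
move=> xa.
have -> : \int[mu]_(y in `[0, x]) (q y * G x t y) =
    \sum_i (c i * (2 * cos (k i * t))) * (phi i x - cos (k i * x)).
  under eq_Rintegral do rewrite GE mulr_sumr.
  rewrite (Rintegral_bigsum _ _).2//; last first.
    move=> i; apply: integrable_mul_continuous => // y.
    by apply: cvgM; [exact: cvg_cst|exact: cterm].
  apply: eq_bigr => i _.
  have [_ ->//] := phiP i; rewrite addrAC subrr add0r.
  under eq_Rintegral do rewrite mulrCA.
  by rewrite RintegralZl//; apply: integrable_mul_continuous => //; exact: cterm.
rewrite /U /theta /cosine_sum -big_split/= !mulr_suml -big_split/=.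
apply: eq_bigr => i _.
by rewrite !mulrDr mulrN cosD cosB; field.
Qed.

Let G_bound x t y : 0 <= y <= x ->
  `|G x t y| <= \int[mu]_(s in `[t - (x - y), t + (x - y)]) `|U y s|.
Proof.
move=> /andP[y0 yx]; rewrite /G -Rintegral_cosine_sum// ?subr_ge0//.
by apply: le_norm_Rintegral_continuous; exact: continuous_cosine_sum.
Qed.

Context (X T : R) (X0a : 0 <= X <= a).

(** The mass of U on the section at depth y of the characteristic triangle with apex (X,T).
    Gronwall's argument runs on these integrals and not on suprema, because theta will approximate
    indicators only in the mean. *)
Let I y := \int[mu]_(s in `[T - X + y, T + X - y]) `|U y s|.
Let N := \int[mu]_(s in `[T - X, T + X]) `|theta s|.

(* If I is at most B on [0, x0] and at most M on [x0, x], so is the size of the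
   inner integrals in the domain of dependence of (X, T). *)
Let wave_step (x0 x B M s : R) : 0 <= x0 <= x -> x <= X ->
  (forall y, 0 <= y <= x0 -> I y <= B) -> (forall y, x0 <= y <= x -> I y <= M) ->
  T - X + x <= s <= T + X - x ->
  `|U x s - (theta (s + x) + theta (s - x)) / 2| <=
  (B * \int[mu]_(y in `[0, x0]) `|q y| + M * \int[mu]_(y in `[x0, x]) `|q y|) / 2.
Proof.
move=> /andP[x00 x0x] xX IB IM /andP[sT1 sT2].
rewrite wave_rep; last by case/andP: X0a => _ Xa; lra.
rewrite addrAC subrr add0r normrM [`|2^-1|]gtr0_norm// ler_wpM2r//.
have GI y : 0 <= y <= x -> `|G x s y| <= I y.
  move=> yx; apply: le_trans (G_bound _ yx) _; case/andP: yx => y0 yx.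
  apply: le_Rintegral_itv_subset => //; last by lra.
  - by apply: continuous_normr; exact: continuous_cosine_sum.
  - by lra.
apply: norm_Rintegral_mul_le => //; first by rewrite x00.
  by move=> y /andP[y0 yx0]; apply: le_trans (GI _ _) (IB _ _); lra.
by move=> y /andP[y0 yx0]; apply: le_trans (GI _ _) (IM _ _); lra.
Qed.

Let cU y : continuous (U y). Proof. exact: continuous_cosine_sum. Qed.
Let ctheta : continuous theta. Proof. exact: continuous_cosine_sum. Qed.
Let cabs_theta : continuous (fun s => `|theta s|).
Proof. exact: continuous_normr. Qed.

Let I_ge0 y : 0 <= I y. Proof. exact: Rintegral_ge0. Qed.

Let translate x (d e : R) : e <= d ->
  \int[mu]_(s in `[e, d]) `|theta (s + x)| = \int[mu]_(s in `[e + x, d + x]) `|theta s|.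
Proof.
move=> ed; have := @Rintegral_affine R (fun s => `|theta s|) e d 1 x ltr01 ed cabs_theta.
rewrite !mul1r => ->; apply: eq_Rintegral => s _.
by rewrite mul1r.
Qed.

(** The bound of [wave_step] is integrated over the section. Shifted by x or by -x, the section
    stays inside [T-X, T+X], so each travelling wave contributes at most N / 2; the remaining term
    is Q / 2 times the length 2 (X - x). *)
Let I_bound (x0 x B M : R) : 0 <= x0 <= x -> x <= X -> 0 <= B -> 0 <= M ->
  (forall y, 0 <= y <= x0 -> I y <= B) -> (forall y, x0 <= y <= x -> I y <= M) ->
  I x <= N + X * (B * \int[mu]_(y in `[0, x0]) `|q y| +
                  M * \int[mu]_(y in `[x0, x]) `|q y|).
Proof.
move=> x0x xX B0 M0 IB IM.
have step := wave_step x0x xX IB IM.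
set Q := B * _ + M * _ in step *.
have Q0 : 0 <= Q by rewrite addr_ge0// mulr_ge0// Rintegral_ge0.
have xge0 : 0 <= x by case/andP: x0x => h1 h2; exact: le_trans h1 h2.
have ed : T - X + x <= T + X - x by lra.
pose e := T - X + x; pose d := T + X - x.
have cshift (z : R) : continuous (fun s => `|theta (s + z)|).
  move=> s; apply: cvg_norm; apply: (continuous_comp (f := fun s => s + z)).
    by apply: cvgD; [exact: cvg_id|exact: cvg_cst].
  exact: ctheta.
pose g s := 2^-1 * `|theta (s + x)| + (2^-1 * `|theta (s + - x)| + Q / 2).
have ch (z : R) : continuous (fun s => 2^-1 * `|theta (s + z)|).
  by move=> s; apply: cvgM; [exact: cvg_cst|exact: cshift].
have cQ : continuous (fun _ : R => Q / 2) by move=> s; exact: cvg_cst.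
have ch2 : continuous (fun s => 2^-1 * `|theta (s + - x)| + Q / 2).
  by move=> s; apply: cvgD; [exact: ch|exact: cQ].
have cg : continuous g by move=> s; apply: cvgD; [exact: ch|exact: ch2].
apply: (@le_trans _ _ (\int[mu]_(s in `[e, d]) g s)).
  apply: le_Rintegral_continuous => //; first exact: continuous_normr.
  move=> s sed; have := step s sed.
  set av := _ / 2 => h.
  have -> : U x s = (U x s - av) + av by rewrite subrK.
  apply: le_trans (ler_normD _ _) _.
  have : `|av| <= 2^-1 * `|theta (s + x)| + 2^-1 * `|theta (s + - x)|.
    rewrite /av normrM [`|2^-1|]gtr0_norm// mulrC -mulrDr ler_wpM2l// ler_normD//.
  move=> h2; have -> : g s =
      Q / 2 + (2^-1 * `|theta (s + x)| + 2^-1 * `|theta (s + - x)|).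
    by rewrite /g addrA addrC.
  exact: lerD.
have ii f : continuous f -> mu.-integrable `[e, d] (EFin \o f).
  exact: continuous_integrable_itv.
rewrite /g RintegralD//; [|exact: (ii _ (ch x))|exact: (ii _ ch2)].
rewrite RintegralD//; [|exact: (ii _ (ch (- x)))|exact: (ii _ cQ)].
have Z z : \int[mu]_(s in `[e, d]) (2^-1 * `|theta (s + z)|) =
    2^-1 * \int[mu]_(s in `[e, d]) `|theta (s + z)|.
  by rewrite RintegralZl//; exact: (ii _ (cshift z)).
rewrite !Z.
rewrite !translate// Rintegral_itv_cst//.
have leN u v : T - X <= u -> v <= T + X -> \int[mu]_(s in `[u, v]) `|theta s| <= N.
  by move=> h1 h2; apply: le_Rintegral_itv_subset.
have le1 : \int[mu]_(s in `[e + x, d + x]) `|theta s| <= N.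
  by apply: leN; rewrite /e /d; lra.
have le2 : \int[mu]_(s in `[e + - x, d + - x]) `|theta s| <= N.
  by apply: leN; rewrite /e /d; lra.
have le3 : Q / 2 * (d - e) <= X * Q.
  have -> : d - e = 2 * (X - x) by rewrite /d /e; ring.
  have -> : Q / 2 * (2 * (X - x)) = (X - x) * Q by field.
  by rewrite ler_wpM2r//; lra.
by move: le1 le2 le3; move: (\int[_]_(_ in _) _) (\int[_]_(_ in _) _) => i1 i2; lra.
Qed.

(** Its value is immaterial: it makes the supremum in [block] finite, so that half of it can be
    absorbed. *)
Let I_apriori : exists K0 : R, forall y, 0 <= y <= X -> I y <= K0.
Proof.
have [K K0 hK] : exists2 K : R, 0 < K & forall y s, 0 <= y <= X -> `|U y s| <= K.
  have : forall i, exists M : R, 0 < M /\ forall y, 0 <= y <= X -> `|phi i y| <= M.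
    by move=> i; have [M M0 hM] := continuous_bounded_itv 0 X (cphi (i := i)); exists M.
  move=> /choice[M hM].
  exists (\sum_i `|c i| * M i + 1).
    by rewrite ltr_wpDl// sumr_ge0// => i _; rewrite mulr_ge0// ltW//; exact: (hM i).1.
  move=> y s yX; apply: le_trans (ler_norm_sum _ _ _) _; rewrite ler_wpDr//.
  apply: ler_sum => i _; rewrite !normrM -[leRHS]mulr1 ler_pM ?mulr_ge0//.
    by rewrite ler_wpM2l//; exact: (hM i).2.
  by rewrite ler_norml cos_geN1 cos_le1.
exists (K * (2 * X)) => y yX; have := yX => /andP[y0 yX'].
apply: (@le_trans _ _ (\int[mu]_(s in `[T - X + y, T + X - y]) K)).
  apply: le_Rintegral_continuous; [exact: continuous_normr|by move=> z; exact: cvg_cst|].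
  by move=> s _; exact: hK.
by rewrite Rintegral_itv_cst; [rewrite ler_wpM2l ?(ltW K0)//; lra|lra].
Qed.

Let L := \int[mu]_(y in `[0, a]) `|q y|.

Let Q_le (u v : R) : 0 <= u -> v <= a -> \int[mu]_(y in `[u, v]) `|q y| <= L.
Proof.
move=> u0 va; apply: le_Rintegral_subset => //.
by move=> x /=; rewrite !in_itv/= => /andP[ux xv]; rewrite (le_trans u0) ?(le_trans xv).
Qed.

Let L_ge0 : 0 <= L. Proof. exact: Rintegral_ge0. Qed.

(* Gronwall's lemma for a weight that is only integrable: on a block [x0, x1]
   carrying little mass of q, the bound on I absorbs itself. *)
Let block (x0 x1 B : R) : 0 <= x0 <= x1 -> x1 <= X -> N <= B ->
  2 * a * \int[mu]_(y in `[x0, x1]) `|q y| <= 1 ->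
  (forall y, 0 <= y <= x0 -> I y <= B) ->
  forall y, 0 <= y <= x1 -> I y <= (2 + 2 * a * L) * B.
Proof.
move=> /andP[x00 x01] x1X NB small IB.
have N0 : 0 <= N by exact: Rintegral_ge0.
have B0 : 0 <= B := le_trans N0 NB.
have [K0 hK0] := I_apriori.
have [X0 Xa] := andP X0a.
have a0 : 0 <= a := le_trans X0 Xa.
have aL : 0 <= a * L by rewrite mulr_ge0.
pose S := [set I y | y in [set y | x0 <= y <= x1]].
have ubS : has_ubound S.
  exists K0 => _ [y /= /andP[y0 y1] <-]; apply: hK0.
  by rewrite (le_trans x00)//= (le_trans y1).
have neS : S !=set0 by exists (I x0), x0 => //=; rewrite lexx.
have IS y : x0 <= y <= x1 -> I y <= sup S.
  by move=> yx; apply: ub_le_sup => //; exists y.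
have S0 : 0 <= sup S by apply: le_trans (IS x0 _); rewrite ?lexx.
(* The known part costs a L B and the new block at most half of the supremum. Solving for the
   supremum yields the factor 2 + 2 a L. *)
have supB : sup S <= B + a * L * B + sup S / 2.
  apply: ge_sup => // _ [x /= /andP[x0x xx1] <-].
  have := @I_bound x0 x B (sup S); rewrite x00 x0x => /(_ isT (le_trans xx1 x1X) B0 S0 IB).
  have IM y : x0 <= y <= x -> I y <= sup S.
    by move=> /andP[h1 h2]; apply: IS; rewrite h1 (le_trans h2).
  move=> /(_ IM) /le_trans; apply.
  have q1 : \int[mu]_(y in `[0, x0]) `|q y| <= L by apply: Q_le => //; lra.
  have q2 : \int[mu]_(y in `[x0, x]) `|q y| <= \int[mu]_(y in `[x0, x1]) `|q y|.
    apply: le_Rintegral_subset => // z /=; rewrite !in_itv/= => /andP[-> zx].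
    exact: le_trans zx xx1.
  rewrite -addrA lerD// mulrDr lerD//.
    rewrite -mulrA ler_pM//; first by rewrite mulr_ge0// Rintegral_ge0.
    by rewrite mulrC ler_wpM2r.
  have : X * (sup S * \int[mu]_(y in `[x0, x]) `|q y|) <=
      a * (sup S * \int[mu]_(y in `[x0, x1]) `|q y|).
    by rewrite ler_pM// ?mulr_ge0 ?Rintegral_ge0// ler_wpM2l.
  move=> /le_trans; apply.
  have -> : a * (sup S * \int[mu]_(y in `[x0, x1]) `|q y|) =
    sup S / 2 * (2 * a * \int[mu]_(y in `[x0, x1]) `|q y|) by field.
  by rewrite ler_piMr// divr_ge0.
have LB : 0 <= a * L * B by rewrite mulr_ge0.
have BE : (2 + 2 * a * L) * B = 2 * B + 2 * (a * L * B) by ring.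
move=> y /andP[y0 y1]; rewrite BE.
have [yx0|x0y] := leP y x0.
  by have := IB y; rewrite y0 yx0 => /(_ isT); lra.
by have := IS y; rewrite (ltW x0y) y1 => /(_ isT); lra.
Qed.

Let phi_0 i : 0 <= a -> phi i 0 = 1.
Proof.
move=> a0; have [_ ->] := phiP i; last by rewrite lexx.
by rewrite set_itv1 Rintegral_set1 addr0 mulr0 cos0.
Qed.

Lemma wave_bound_blocks (h : R) (m : nat) : 0 < h ->
  (forall u v, 0 <= u <= v -> v - u <= h ->
    2 * a * \int[mu]_(y in `[u, v]) `|q y| <= 1) ->
  a <= m%:R * h ->
  `|U X T - (theta (T + X) + theta (T - X)) / 2| <=
  (2 + 2 * a * L) ^+ m * L * N.
Proof.
move=> h0 small amh; have [X0 Xa] := andP X0a.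
have a0 : 0 <= a := le_trans X0 Xa.
have N0 : 0 <= N by exact: Rintegral_ge0.
have aL : 0 <= 2 * a * L by rewrite !mulr_ge0.
have K1 : 1 <= 2 + 2 * a * L by lra.
have key (j : nat) : forall y, 0 <= y <= X -> y <= j%:R * h ->
    I y <= (2 + 2 * a * L) ^+ j * N.
  elim: j => [|j IHj] y /andP[y0 yX].
    rewrite mul0r => yle; have -> : y = 0 by apply/eqP; rewrite eq_le yle.
    rewrite expr0 mul1r /I addr0 subr0 /N le_eqVlt; apply/orP; left; apply/eqP.
    apply: eq_Rintegral => s _; congr `|_|; rewrite /U /theta; congr (cosine_sum _ _ _).
    by apply/funext => i; rewrite phi_0// mulr1.
  move=> yj; rewrite exprS -mulrA.
  have jh : 0 <= j%:R * h by rewrite mulr_ge0// ltW.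
  (* The blocks are cut at X, beyond which the triangle has no sections. *)
  apply: (@block (Num.min X (j%:R * h)) (Num.min X (j.+1%:R * h))).
  - rewrite le_min X0 jh /= le_min ge_min lexx/= ge_min; apply/orP; right.
    by rewrite ler_wpM2r ?(ltW h0)// ler_nat.
  - by rewrite ge_min lexx.
  - by rewrite ler_peMl// exprn_ege1.
  - apply: small.
      rewrite le_min X0 jh /= le_min ge_min lexx/= ge_min; apply/orP; right.
      by rewrite ler_wpM2r ?(ltW h0)// ler_nat.
    rewrite -natr1 mulrDl mul1r.
    by case: (leP X (j%:R * h)); case: (leP X (j%:R * h + h)); lra.
  - by move=> z; rewrite le_min => /and3P[z0 zX zj]; apply: IHj => //; rewrite z0.
  - by rewrite y0 le_min yX yj.
have IB y : 0 <= y <= X -> I y <= (2 + 2 * a * L) ^+ m * N.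
  move=> yX; apply: key => //; case/andP: yX => _ yX.
  exact: le_trans yX (le_trans Xa amh).
have IM y : X <= y <= X -> I y <= (2 + 2 * a * L) ^+ m * N.
  by move=> /andP[Xy yX]; apply: IB; rewrite (le_trans X0).
(* At depth X the section is the single point T, and splitting at x0 = X makes the second integral
   vanish. *)
have := @wave_step X X _ _ T; rewrite X0 !lexx => /(_ _ _ isT isT IB IM).
have -> : T - X + X <= T <= T + X - X by lra.
move=> /(_ isT) /le_trans; apply.
rewrite set_itv1 Rintegral_set1 mulr0 addr0.
rewrite [leRHS](_ : _ = (2 + 2 * a * L) ^+ m * N * L); last by ring.
have KN : 0 <= (2 + 2 * a * L) ^+ m * N by rewrite mulr_ge0// exprn_ge0; lra.
have := Q_le (lexx 0) Xa => /(ler_wpM2l KN).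
have := mulr_ge0 KN L_ge0; lra.
Qed.

End wave_bound.

(** The constant is chosen before the frequencies and the coefficients. The blocks depend on q and a
    alone, through the absolute continuity of the integral of |q|. *)
Lemma wave_estimate (q : R -> R) (a : R) : 0 < a ->
  (@lebesgue_measure R).-integrable setT (EFin \o q) ->
  exists2 C : R, 0 <= C & forall n (c k : 'I_n -> R) (phi : 'I_n -> R -> R),
    (forall i, 0 < k i) -> (forall i, duhamel_solution q a (k i) (phi i)) ->
    forall X T : R, 0 <= X <= a ->
    `|cosine_sum (fun i => c i * phi i X) k T -
      (cosine_sum c k (T + X) + cosine_sum c k (T - X)) / 2| <=
    C * \int[mu]_(s in `[T - X, T + X]) `|cosine_sum c k s|.
Proof.
move=> a0 iq.
(* The threshold at which a block satisfies 2 a int |q| <= 1. The length [h] is then half of the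
   modulus [d], since the modulus asks for a strict inequality. *)
have e0 : 0 < (2 * a)^-1 by rewrite invr_gt0 mulr_gt0.
have [d [d0 hd]] := integral_normr_continuous iq e0.
pose h := d / 2; have h0 : 0 < h by rewrite divr_gt0.
have [m hm] : exists m : nat, a <= m%:R * h.
  exists (Num.truncn (a / h)).+1; rewrite -ler_pdivrMr//; apply: ltW.
  exact: truncnS_gt.
exists ((2 + 2 * a * \int[mu]_(y in `[0, a]) `|q y|) ^+ m *
  \int[mu]_(y in `[0, a]) `|q y|).
  have L0 : 0 <= \int[mu]_(y in `[0, a]) `|q y| by exact: Rintegral_ge0.
  by rewrite mulr_ge0// exprn_ge0// addr_ge0// !mulr_ge0// ltW.
move=> n c k phi k0 phiP X T Xa.
apply: (wave_bound_blocks c iq k0 phiP T Xa h0) => // u v /andP[u0 uv] vu.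
rewrite -ler_pdivlMl ?mulr_gt0// mulr1 ltW//; apply: hd; first exact: measurable_itv.
have : (@lebesgue_measure R `[u, v]%classic < d%:E)%E.
  rewrite lebesgue_measure_itv/= lte_fin; case: ifPn => _; rewrite lte_fin//.
  by apply: le_lt_trans vu _; rewrite /h ltr_pdivrMr// ltr_pMr// ltr1n.
exact.
Qed.

End wave_equation.

(** * Products of solutions of two equations *)

Section product_of_solutions.
Context {R : realType}.
Implicit Types (q f g : R -> R) (a b x y s t : R).

Lemma Rintegral_reflect g a b : a <= b -> continuous g ->
  \int[mu]_(x in `[- b, - a]) g x = \int[mu]_(x in `[a, b]) g (- x).
Proof.
move=> ab cg; rewrite /Rintegral integration_by_substitution_oppr//.
exact: continuous_subspaceT.
Qed.

Lemma Rintegral_cat g a b c : a <= b -> b <= c -> continuous g ->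
  \int[mu]_(x in `[a, c]) g x = \int[mu]_(x in `[a, b]) g x + \int[mu]_(x in `[b, c]) g x.
Proof.
move=> ab bc cg.
rewrite -(@Rintegral_itv_obnd_cbnd _ b); last first.
  by apply: integrableS (continuous_integrable_itv b c cg) => //; exact: subset_itv_oc_cc.
rewrite -(@Rintegral_itvB _ _ (BLeft a) (BRight c)) ?bnd_simp//.
  by rewrite addrC subrK.
exact: continuous_integrable_itv.
Qed.

Lemma cosine_sum_even n (c k : 'I_n -> R) s : cosine_sum c k (- s) = cosine_sum c k s.
Proof. by apply: eq_bigr => i _; rewrite mulrN cosN. Qed.

(** The wave for q1 at depth X, th'(s) = sum_i c_i phi1_i(X) cos(k_i s), is taken as datum of a wave
    for q2, whose value at (X,0) is the sum of products. Evenness reduces its d'Alembert part to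
    th'(X), and the estimate for q1 at (X,X) compares th'(X) with (theta(2X) + theta(0)) / 2. *)
Lemma product_estimate (q1 q2 : R -> R) (a : R) : 0 < a ->
  (@lebesgue_measure R).-integrable setT (EFin \o q1) ->
  (@lebesgue_measure R).-integrable setT (EFin \o q2) ->
  exists2 C : R, 0 <= C & forall n (c k : 'I_n -> R) (phi1 phi2 : 'I_n -> R -> R),
    (forall i, 0 < k i) ->
    (forall i, duhamel_solution q1 a (k i) (phi1 i)) ->
    (forall i, duhamel_solution q2 a (k i) (phi2 i)) ->
    forall X : R, 0 <= X <= a ->
    `|\sum_i c i * (phi1 i X * phi2 i X) -
      (cosine_sum c k (2 * X) + cosine_sum c k 0) / 2| <=
    C * \int[mu]_(x in `[0, X]) `|cosine_sum c k (2 * x)|.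
Proof.
move=> a0 iq1 iq2.
have [C1 C10 H1] := wave_estimate a0 iq1.
have [C2 C20 H2] := wave_estimate a0 iq2.
(* C1 is the error of the first wave at (X,X). C2 multiplies the integral of |th'| over [-X,X],
   which is at most 1 + 4 a C1 times M. The factor 2 comes from the substitution s = 2x. *)
exists (2 * (C1 + C2 * (1 + 4 * a * C1))).
  by rewrite !(mulr_ge0, addr_ge0)// ltW.
move=> n c k phi1 phi2 k0 P1 P2 X /[dup] Xa /andP[X0 Xa'].
pose th := cosine_sum c k.
pose th' := cosine_sum (fun i => c i * phi1 i X) k.
have cth : continuous (fun s => `|th s|).
  by apply: continuous_normr; exact: continuous_cosine_sum.
have cth' : continuous (fun s => `|th' s|).
  by apply: continuous_normr; exact: continuous_cosine_sum.
pose M := \int[mu]_(s in `[0, 2 * X]) `|th s|.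
have M0 : 0 <= M by exact: Rintegral_ge0.
have ME : M = 2 * \int[mu]_(x in `[0, X]) `|th (2 * x)|.
  have := @Rintegral_affine R (fun s => `|th s|) 0 X 2 0 _ X0 cth.
  rewrite mulr0 !addr0 /M => -> //; congr (_ * _).
  by apply: eq_Rintegral => x _; rewrite addr0.
have MN : \int[mu]_(s in `[- (2 * X), 0]) `|th s| = M.
  rewrite -[X in `[_, X]]oppr0 Rintegral_reflect ?mulr_ge0//.
  by apply: eq_Rintegral => s _; rewrite /th cosine_sum_even.
have M2 : \int[mu]_(s in `[- (2 * X), 2 * X]) `|th s| = 2 * M.
  by rewrite (@Rintegral_cat _ _ 0)// ?MN -/M ?oppr_le0 ?mulr_ge0//; ring.
have tr d : \int[mu]_(s in `[- X, X]) `|th (s + d)| =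
    \int[mu]_(s in `[- X + d, X + d]) `|th s|.
  have XX : - X <= X by lra.
  have := @Rintegral_affine R (fun s => `|th s|) (- X) X 1 d ltr01 XX cth.
  by rewrite !mul1r => ->; apply: eq_Rintegral => s _; rewrite mul1r.
have cshift (z : R) : continuous (fun s => `|th (s + z)|).
  move=> s; apply: cvg_norm; apply: (continuous_comp (f := fun s => s + z)).
    by apply: cvgD; [exact: cvg_id|exact: cvg_cst].
  exact: continuous_cosine_sum.
have th'b s : - X <= s <= X ->
    `|th' s| <= 2^-1 * `|th (s + X)| + (2^-1 * `|th (s + - X)| + C1 * (2 * M)).
  move=> /andP[s1 s2]; have h := H1 n c k phi1 k0 P1 X s Xa.
  have h2 : \int[mu]_(u in `[s - X, s + X]) `|th u| <= 2 * M.
    by rewrite -M2; apply: le_Rintegral_itv_subset => //; lra.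
  have h3 := le_trans h (ler_wpM2l C10 h2).
  have -> : th' s = (th' s - (th (s + X) + th (s - X)) / 2) + (th (s + X) + th (s - X)) / 2.
    by rewrite subrK.
  apply: le_trans (ler_normD _ _) _.
  have h4 : `|(th (s + X) + th (s - X)) / 2| <= 2^-1 * `|th (s + X)| + 2^-1 * `|th (s + - X)|.
    by rewrite normrM [`|2^-1|]gtr0_norm// mulrC -mulrDr ler_wpM2l// ler_normD.
  by rewrite addrA [leRHS]addrC; apply: lerD.
have th'int : \int[mu]_(s in `[- X, X]) `|th' s| <= (1 + 4 * a * C1) * M.
  have ch (z : R) : continuous (fun s => 2^-1 * `|th (s + z)|).
    by move=> s; apply: cvgM; [exact: cvg_cst|exact: cshift].
  have cQ : continuous (fun _ : R => C1 * (2 * M)) by move=> s; exact: cvg_cst.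
  have ch2 : continuous (fun s => 2^-1 * `|th (s + - X)| + C1 * (2 * M)).
    by move=> s; apply: cvgD; [exact: ch|exact: cQ].
  have cg : continuous (fun s => 2^-1 * `|th (s + X)| + (2^-1 * `|th (s + - X)| + C1 * (2 * M))).
    by move=> s; apply: cvgD; [exact: ch|exact: ch2].
  apply: le_trans (le_Rintegral_continuous cth' cg th'b) _.
  have ii f : continuous f -> mu.-integrable `[- X, X] (EFin \o f).
    exact: continuous_integrable_itv.
  rewrite RintegralD//; [|exact: (ii _ (ch X))|exact: (ii _ ch2)].
  rewrite RintegralD//; [|exact: (ii _ (ch (- X)))|exact: (ii _ cQ)].
  have Z z : \int[mu]_(s in `[- X, X]) (2^-1 * `|th (s + z)|) =
      2^-1 * \int[mu]_(s in `[- X, X]) `|th (s + z)|.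
    by rewrite RintegralZl//; exact: (ii _ (cshift z)).
  rewrite !Z !tr Rintegral_itv_cst; last by lra.
  rewrite addNr subrr (_ : X + X = 2 * X); last by ring.
  rewrite (_ : - X + - X = - (2 * X)); last by ring.
  rewrite MN -/M (_ : X - - X = 2 * X); last by ring.
  have : X * (C1 * M) <= a * (C1 * M) by rewrite ler_wpM2r// mulr_ge0.
  have -> : (1 + 4 * a * C1) * M = M + 4 * (a * (C1 * M)) by ring.
  have -> : C1 * (2 * M) * (2 * X) = 4 * (X * (C1 * M)) by ring.
  by move: (X * (C1 * M)) (a * (C1 * M)) => u v; lra.
have E2 := H2 n (fun i => c i * phi1 i X) k phi2 k0 P2 X 0 Xa.
have E1 := H1 n c k phi1 k0 P1 X X Xa.
rewrite !add0r cosine_sum_even in E2.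
rewrite subrr (_ : X + X = 2 * X) in E1; last by ring.
have {}E2 := le_trans E2 (ler_wpM2l C20 th'int).
have WE : cosine_sum (fun i => c i * phi1 i X * phi2 i X) k 0 =
    \sum_i c i * (phi1 i X * phi2 i X).
  by apply: eq_bigr => i _; rewrite mulr0 cos0 mulr1 mulrA.
rewrite WE -/th' in E2; rewrite -/th -/th' -/M in E1.
have -> : 2 * (C1 + C2 * (1 + 4 * a * C1)) * \int[mu]_(x in `[0, X]) `|th (2 * x)| =
    C1 * M + C2 * ((1 + 4 * a * C1) * M) by rewrite ME; ring.
rewrite -/th; set W := \sum_i _ in E2 *.
have -> : W - (th (2 * X) + th 0) / 2 =
   (th' X - (th (2 * X) + th 0) / 2) + (W - (th' X + th' X) / 2) by field.
by apply: le_trans (ler_normD _ _) _; exact: lerD.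
Qed.

(** Orthogonality removes the sum of products, so that p is integrated against the error of
    [product_estimate] only. The split at [al] keeps the causality of that error. *)
Lemma orthogonal_products_bound (q1 q2 p : R -> R) (a : R) : 0 < a ->
  (@lebesgue_measure R).-integrable setT (EFin \o q1) ->
  (@lebesgue_measure R).-integrable setT (EFin \o q2) ->
  (@lebesgue_measure R).-integrable setT (EFin \o p) ->
  exists2 C : R, 0 <= C & forall n (c k : 'I_n -> R) (phi1 phi2 : 'I_n -> R -> R),
    (forall i, 0 < k i) ->
    (forall i, duhamel_solution q1 a (k i) (phi1 i)) ->
    (forall i, duhamel_solution q2 a (k i) (phi2 i)) ->
    (forall i, \int[mu]_(x in `[0, a]) (p x * (phi1 i x * phi2 i x)) = 0) ->
    forall al B M : R, 0 <= al <= a ->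
    (forall y, 0 <= y <= al -> \int[mu]_(x in `[0, y]) `|cosine_sum c k (2 * x)| <= B) ->
    (forall y, al <= y <= a -> \int[mu]_(x in `[0, y]) `|cosine_sum c k (2 * x)| <= M) ->
    `|\int[mu]_(x in `[0, a]) (p x * (cosine_sum c k (2 * x) + cosine_sum c k 0))| <=
    C * (B * \int[mu]_(x in `[0, al]) `|p x| + M * \int[mu]_(x in `[al, a]) `|p x|).
Proof.
move=> a0 iq1 iq2 ip; have [C C0 H] := product_estimate a0 iq1 iq2.
exists (2 * C); first by rewrite mulr_ge0.
move=> n c k phi1 phi2 k0 P1 P2 orth al B M ala hB hM.
pose W x := \sum_i c i * (phi1 i x * phi2 i x).
have cpp i : continuous (fun x => phi1 i x * phi2 i x).
  by move=> x; apply: cvgM; [exact: (P1 i).1|exact: (P2 i).1].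
have cW : continuous W.
  by apply: continuous_bigsum => i x; apply: cvgM; [exact: cvg_cst|exact: cpp].
have cth : continuous (fun x => cosine_sum c k (2 * x)).
  move=> x; apply: (continuous_comp (f := fun x => 2 * x)).
    by apply: cvgM; [exact: cvg_cst|exact: cvg_id].
  exact: continuous_cosine_sum.
have cav : continuous (fun x => (cosine_sum c k (2 * x) + cosine_sum c k 0) / 2).
  move=> x; apply: cvgM; last exact: cvg_cst.
  by apply: cvgD; [exact: cth|exact: cvg_cst].
pose g x := W x - (cosine_sum c k (2 * x) + cosine_sum c k 0) / 2.
have cg : continuous g by move=> x; apply: cvgB; [exact: cW|exact: cav].
have ipi : mu.-integrable `[0, a] (EFin \o p) by exact: integrableS ip.
have IW : \int[mu]_(x in `[0, a]) (p x * W x) = 0.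
  under eq_Rintegral do rewrite mulr_sumr.
  rewrite (Rintegral_bigsum _ _).2//; last first.
    move=> i; apply: integrable_mul_continuous => // y.
    by apply: cvgM; [exact: cvg_cst|exact: cpp].
  apply: big1 => i _; under eq_Rintegral do rewrite mulrCA.
  rewrite RintegralZl// ?orth ?mulr0//.
  by apply: integrable_mul_continuous.
have Ig : \int[mu]_(x in `[0, a]) (p x * (cosine_sum c k (2 * x) + cosine_sum c k 0)) =
    - 2 * \int[mu]_(x in `[0, a]) (p x * g x).
  have -> : \int[mu]_(x in `[0, a]) (p x * g x) = \int[mu]_(x in `[0, a]) (p x * W x) -
      \int[mu]_(x in `[0, a]) (p x * ((cosine_sum c k (2 * x) + cosine_sum c k 0) / 2)).
    rewrite -RintegralB//; [|exact: integrable_mul_continuous..].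
    by apply: eq_Rintegral => x _; rewrite mulrBr.
  rewrite IW sub0r mulrNN -RintegralZl//; last exact: integrable_mul_continuous.
  by apply: eq_Rintegral => x _; field.
rewrite Ig normrM normrN [`|2|]gtr0_norm// -mulrA ler_wpM2l//.
have [al0 ala'] := andP ala.
have := @norm_Rintegral_mul_le R p g al a (C * B) (C * M) ip cg ala.
rewrite mulrDr !mulrA; apply.
  move=> y /andP[y0 yal]; apply: le_trans (H _ _ _ _ _ k0 P1 P2 y _) _.
    by rewrite y0 (le_trans yal).
  by rewrite ler_wpM2l// hB// y0.
move=> y /andP[y0 yal]; apply: le_trans (H _ _ _ _ _ k0 P1 P2 y _) _.
  by rewrite (le_trans al0).
by rewrite ler_wpM2l// hM// y0.
Qed.

End product_of_solutions.

(** * Approximation by cosine sums *)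

Section bounded_pointwise_closure.
Context {R : realType}.
Implicit Types (f g w : R -> R) (a b x y s t : R).

(* An inductive closure is needed: bounded pointwise limits of bounded pointwise
   limits need not be bounded pointwise limits of elements of S. *)
Inductive bp_closure a (S : set (R -> R)) : (R -> R) -> Prop :=
| bp_zero : bp_closure a S (fun _ => 0)
| bp_base f : S f -> bp_closure a S f
| bp_lin (c : R) f g : bp_closure a S f -> bp_closure a S g ->
    bp_closure a S (fun x => c * f x + g x)
| bp_lim (f_ : nat -> R -> R) f (M : R) :
    (forall n, bp_closure a S (f_ n)) ->
    (forall n x, 0 <= x <= a -> `|f_ n x| <= M) ->
    (forall x, 0 <= x <= a -> f_ n x @[n --> \oo] --> f x) ->
    bp_closure a S f.

Lemma integrable_mul_bounded w g a b (M : R) :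
  mu.-integrable `[a, b] (EFin \o w) ->
  measurable_fun (`[a, b]%classic : set R) g ->
  (forall x, a <= x <= b -> `|g x| <= M) ->
  mu.-integrable `[a, b] (EFin \o (fun x => w x * g x)).
Proof.
move=> iw mg gM.
have bg : [bounded g x | x in (`[a, b]%classic : set R)].
  exists M; split; first exact: num_real.
  by move=> N MN x /= xab; rewrite (le_trans (gM x _) (ltW MN))// -in_itv.
by have := integrableMl _ iw mg bg; apply; exact: measurable_itv.
Qed.

Lemma weighted_bounded_cvg w a (f_ : nat -> R -> R) f (M : R) :
  mu.-integrable `[0, a] (EFin \o w) -> (forall x, 0 <= w x) ->
  (forall n, measurable_fun (`[0, a]%classic : set R) (f_ n)) ->
  measurable_fun (`[0, a]%classic : set R) f ->
  (forall n x, 0 <= x <= a -> `|f_ n x| <= M) ->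
  (forall x, 0 <= x <= a -> `|f x| <= M) ->
  (forall x, 0 <= x <= a -> f_ n x @[n --> \oo] --> f x) ->
  \int[mu]_(x in `[0, a]) (w x * `|f x - f_ n x|) @[n --> \oo] --> (0 : R).
Proof.
move=> iw w0 mf_ mf bf_ bf cvf.
have mm n : measurable_fun (`[0, a]%classic : set R) (fun x => `|f x - f_ n x|).
  by apply: measurableT_comp => //; exact: measurable_funB.
have bb n x : 0 <= x <= a -> `|(`|f x - f_ n x|)| <= 2 * M.
  move=> xa; rewrite normr_id; apply: le_trans (ler_normB _ _) _.
  by have := bf x xa; have := bf_ n x xa; lra.
have ii n : mu.-integrable `[0, a] (EFin \o (fun x => w x * `|f x - f_ n x|)).
  exact: integrable_mul_bounded iw (mm n) (bb n).
have h1 : {ae @lebesgue_measure R, forall x, (`[0, a]%classic : set R) x ->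
    (w x * `|f x - f_ n x|)%:E @[n --> \oo] --> 0%:E}.
  apply: aeW => x /=; rewrite in_itv/= => xa; apply: cvg_EFin.
    by apply: nearW.
  rewrite [X in _ --> X](_ : _ = w x * `|f x - f x|); last by rewrite subrr normr0 mulr0.
  apply: cvgM; first exact: cvg_cst.
  by apply: cvg_norm; apply: cvgB; [exact: cvg_cst|exact: cvf].
have h2 : mu.-integrable `[0, a] (EFin \o (fun x => w x * (2 * M))).
  have cK : continuous (fun _ : R => 2 * M) by move=> z; exact: cvg_cst.
  exact: integrable_mul_continuous.
have h3 : {ae @lebesgue_measure R, forall x n, (`[0, a]%classic : set R) x ->
    (`|(w x * `|f x - f_ n x|)%:E| <= (w x * (2 * M))%:E)%E}.
  apply: aeW => x n /=; rewrite in_itv/= => xa; rewrite lee_fin normrM ger0_norm//.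
  by rewrite ler_wpM2l// bb.
have mi n : measurable_fun (`[0, a]%classic : set R)
    (EFin \o (fun x => w x * `|f x - f_ n x|)).
  by case/integrableP : (ii n).
have [_ _ H] := @dominated_convergence _ _ _ mu `[0, a]%classic (measurable_itv _)
  (fun n => EFin \o (fun x => w x * `|f x - f_ n x|)) (fun=> 0%E)
  (EFin \o (fun x => w x * (2 * M))) mi (measurable_cst _) h1 h2 h3.
rewrite integral0 in H.
by have /fine_cvg := H.
Qed.

Lemma cosine_sum_cat (D : set R) n1 (c1 k1 : 'I_n1 -> R) n2 (c2 k2 : 'I_n2 -> R) (e : R) :
  (forall i, D (k1 i)) -> (forall i, D (k2 i)) ->
  exists n (c k : 'I_n -> R), (forall i, D (k i)) /\
    forall s, cosine_sum c k s = e * cosine_sum c1 k1 s + cosine_sum c2 k2 s.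
Proof.
move=> D1 D2; exists (n1 + n2)%N.
exists (fun i => match fintype.split i with inl j => e * c1 j | inr j => c2 j end).
exists (fun i => match fintype.split i with inl j => k1 j | inr j => k2 j end).
split; first by move=> i; case: fintype.split.
move=> s; rewrite /cosine_sum big_split_ord/=; congr (_ + _).
  rewrite mulr_sumr; apply: eq_bigr => i _.
  by rewrite -[lshift _ _]/(unsplit (inl i)) unsplitK mulrA.
by apply: eq_bigr => i _; rewrite -[rshift _ _]/(unsplit (inr i)) unsplitK.
Qed.

Lemma continuous_cosine_sum2 n (c k : 'I_n -> R) :
  continuous (fun x => cosine_sum c k (2 * x)).
Proof.
move=> x; apply: (continuous_comp (f := fun x => 2 * x)).
  by apply: cvgM; [exact: cvg_cst|exact: cvg_id].
exact: continuous_cosine_sum.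
Qed.

(** Induction on the closure; at a limit, one term of the sequence is close to f by dominated
    convergence and is itself approximated. The value at 0 is tracked apart, as the integral does
    not see it although theta(0) enters the orthogonality bound. *)
Lemma bp_closure_approx a w (D : set R) f : 0 < a ->
  mu.-integrable `[0, a] (EFin \o w) -> (forall x, 0 <= w x) ->
  bp_closure a [set f | exists2 k, D k & f = fun x => cos (k * (2 * x))] f ->
  [/\ measurable_fun (`[0, a]%classic : set R) f,
      exists M : R, forall x, 0 <= x <= a -> `|f x| <= M &
      forall e : R, 0 < e -> exists n (c k : 'I_n -> R),
        [/\ forall i, D (k i), `|f 0 - cosine_sum c k 0| < e &
        \int[mu]_(x in `[0, a]) (w x * `|f x - cosine_sum c k (2 * x)|) < e]].
Proof.
move=> a0 iw w0.
have ch (g : R -> R) n (c k : 'I_n -> R) (M : R) :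
    measurable_fun (`[0, a]%classic : set R) g -> (forall x, 0 <= x <= a -> `|g x| <= M) ->
    mu.-integrable `[0, a] (EFin \o (fun x => w x * `|g x - cosine_sum c k (2 * x)|)).
  move=> mg gM; have [N N0 hN] := continuous_bounded_itv 0 a (@continuous_cosine_sum2 n c k).
  apply: (@integrable_mul_bounded w (fun x => `|g x - cosine_sum c k (2 * x)|) 0 a (M + N)) => //.
    apply: measurableT_comp => //; apply: measurable_funB => //.
    by apply: measurable_funTS; apply: continuous_measurable_fun; exact: continuous_cosine_sum2.
  move=> x xa; rewrite normr_id; apply: le_trans (ler_normB _ _) _.
  by rewrite lerD ?gM ?hN.
elim=> {f} [|f [k Dk ->]|c f g _ [mf [Mf bf] apf] _ [mg [Mg bg] apg]|f_ f M _ IH bf_ cvf].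
- split; first exact: measurable_cst.
    by exists 0 => x _; rewrite normr0.
  move=> e e0; exists 0%N, (fun _ => 0), (fun _ => 0); split => //; first by case.
    by rewrite /cosine_sum big_ord0 subrr normr0.
  under eq_Rintegral do rewrite /cosine_sum big_ord0 subrr normr0 mulr0.
  by rewrite Rintegral_cst// mul0r.
- have cE : (fun x => cos (k * (2 * x))) =
      (fun x => cosine_sum (fun _ : 'I_1 => 1) (fun _ => k) (2 * x)).
    by apply/funext => x; rewrite /cosine_sum big_ord1 mul1r.
  split.
  + by rewrite cE; apply: measurable_funTS; apply: continuous_measurable_fun; exact: continuous_cosine_sum2.
  + have [N N0 hN] := continuous_bounded_itv 0 a
      (@continuous_cosine_sum2 1 (fun _ : 'I_1 => 1) (fun _ => k)).
    by exists N => x xa; have := hN x xa; rewrite /cosine_sum big_ord1 mul1r.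
  + move=> e e0; exists 1%N, (fun _ => 1), (fun _ => k); split => //.
      by rewrite /cosine_sum big_ord1 mul1r !mulr0 subrr normr0.
    under eq_Rintegral do rewrite /cosine_sum big_ord1 mul1r subrr normr0 mulr0.
    by rewrite Rintegral_cst// mul0r.
- have mfg : measurable_fun (`[0, a]%classic : set R) (fun x => c * f x + g x).
    by apply: measurable_funD => //; apply: measurable_funM => //; exact: measurable_cst.
  have bfg x : 0 <= x <= a -> `|c * f x + g x| <= `|c| * Mf + Mg.
    move=> xa; apply: le_trans (ler_normD _ _) _; rewrite normrM lerD ?bg//.
    by rewrite ler_wpM2l ?bf.
  split => //; first by exists (`|c| * Mf + Mg).
  move=> e e0; have c0 : 0 < `|c| + 1 by rewrite ltr_wpDl.
  have e1 : 0 < e / 2 / (`|c| + 1) by rewrite !divr_gt0.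
  have e2 : 0 < e / 2 by rewrite divr_gt0.
  have [n1 [c1 [k1 [D1 z1 i1]]]] := apf _ e1.
  have [n2 [c2 [k2 [D2 z2 i2]]]] := apg _ e2.
  have [n [c' [k' [D' E']]]] := cosine_sum_cat c1 c2 c D1 D2.
  exists n, c', k'; split => //.
    rewrite E' (_ : _ - _ = c * (f 0 - cosine_sum c1 k1 0) + (g 0 - cosine_sum c2 k2 0));
      last by ring.
    apply: le_lt_trans (ler_normD _ _) _; rewrite [e]splitr ler_ltD//.
    rewrite normrM; rewrite ltr_pdivlMr// in z1; apply: ltW; apply: le_lt_trans z1.
    by rewrite mulrC ler_wpM2l// lerDl.
  apply: (@le_lt_trans _ _ (`|c| * \int[mu]_(x in `[0, a]) (w x * `|f x - cosine_sum c1 k1 (2 * x)|) +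
     \int[mu]_(x in `[0, a]) (w x * `|g x - cosine_sum c2 k2 (2 * x)|))).
    have if1 := ch f n1 c1 k1 Mf mf bf; have ig1 := ch g n2 c2 k2 Mg mg bg.
    have icf := @integrableZl _ _ _ mu `[0, a]%classic (measurable_itv _) `|c| _ if1.
    rewrite -RintegralZl// -RintegralD//.
    apply: le_Rintegral => //; first exact: (ch _ _ _ _ _ mfg bfg).
      by have := @integrableD _ _ _ mu `[0, a]%classic (measurable_itv _) _ _ icf ig1.
    move=> x _; rewrite E' mulrCA -mulrDr ler_wpM2l//.
    rewrite (_ : c * f x + g x - _ =
      c * (f x - cosine_sum c1 k1 (2 * x)) + (g x - cosine_sum c2 k2 (2 * x))); last by ring.
    by rewrite -normrM ler_normD.
  rewrite [e]splitr ler_ltD//; rewrite ltr_pdivlMr// in i1.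
  apply: ltW; apply: le_lt_trans i1; rewrite mulrC ler_wpM2l//; last by rewrite lerDl.
  by apply: Rintegral_ge0 => x _; rewrite mulr_ge0.
- have mf : measurable_fun (`[0, a]%classic : set R) f.
    apply: (@measurable_fun_cvg _ _ _ _ f_) => [n|x /=].
      by have [] := IH n.
    by rewrite in_itv/= => xa; exact: cvf.
  have bf x : 0 <= x <= a -> `|f x| <= M.
    move=> xa; have cn : `|f_ n x| @[n --> \oo] --> `|f x| by apply: cvg_norm; exact: cvf.
    rewrite -(cvg_lim (@Rhausdorff R) cn); apply: limr_le.
      by apply/cvg_ex; exists `|f x|.
    by apply: nearW => n; exact: bf_.
  split => //; first by exists M.
  move=> e e0; have e2 : 0 < e / 2 by rewrite divr_gt0.
  have H1 := weighted_bounded_cvg iw w0 (fun n => let: And3 h _ _ := IH n in h) mf bf_ bf cvf.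
  have H2 := cvf 0 _; rewrite lexx (ltW a0) in H2; have {}H2 := H2 isT.
  move/cvgrPdist_lt : H1 => /(_ _ e2)[N1 _ hN1].
  move/cvgrPdist_lt : H2 => /(_ _ e2)[N2 _ hN2].
  pose N := maxn N1 N2.
  have l1 := hN1 N (leq_maxl _ _); have l2 := hN2 N (leq_maxr _ _).
  rewrite /= sub0r normrN in l1; rewrite /= in l2.
  have [mfN _ /(_ _ e2)[n [c [k [Dk z iz]]]]] := IH N.
  exists n, c, k; split => //.
    rewrite [e]splitr (_ : f 0 - _ = (f 0 - f_ N 0) + (f_ N 0 - cosine_sum c k 0)); last by ring.
    by apply: le_lt_trans (ler_normD _ _) _; exact: ltrD.
  have {}l1 := le_lt_trans (ler_norm _) l1.
  rewrite [e]splitr; apply: le_lt_trans (ltrD l1 iz).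
  have i1 : mu.-integrable `[0, a] (EFin \o (fun x => w x * `|f x - f_ N x|)).
    apply: (@integrable_mul_bounded w (fun x => `|f x - f_ N x|) 0 a (M + M)) => //.
      by apply: measurableT_comp => //; exact: measurable_funB.
    by move=> x xa; rewrite normr_id; apply: le_trans (ler_normB _ _) _; rewrite lerD ?bf ?bf_.
  have i2 := ch (f_ N) n c k M mfN (bf_ N).
  rewrite -RintegralD//; apply: le_Rintegral => //; first exact: (ch f n c k M mf bf).
    by have := @integrableD _ _ _ mu `[0, a]%classic (measurable_itv _) _ _ i1 i2.
  move=> x _; rewrite -mulrDr ler_wpM2l//.
  rewrite (_ : f x - _ = (f x - f_ N x) + (f_ N x - cosine_sum c k (2 * x))); last by ring.
  exact: ler_normD.
Qed.

End bounded_pointwise_closure.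

(** * All frequencies and polynomials in a cosine belong to the closure *)

Section closure_of_cosines.
Context {R : realType}.
Implicit Types (f g w : R -> R) (a b x y s t : R).

Lemma is_derive_bigsum n (f : nat -> R -> R) (df : nat -> R) x :
  (forall i, is_derive x (1 : R) (f i) (df i)) ->
  is_derive x (1 : R) (fun y => \sum_(i < n) f i y) (\sum_(i < n) df i).
Proof.
move=> dfi; elim: n => [|n IHn].
  rewrite big_ord0 (_ : (fun y => _) = cst 0); first exact: is_derive_cst.
  by apply/funext => y; rewrite big_ord0.
rewrite big_ord_recr/= (_ : (fun y => _) = (fun y => \sum_(i < n) f i y + f n y)).
  exact: is_derive_add.
by apply/funext => y; rewrite big_ord_recr.
Qed.

Lemma is_derive_expn (n : nat) x :
  is_derive x (1 : R) (fun y => y ^+ n) (n%:R * x ^+ n.-1).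
Proof.
elim: n => [|n IHn].
  rewrite mul0r (_ : (fun y => _) = cst 1); first exact: is_derive_cst.
  by apply/funext => y; rewrite expr0.
have h := is_derive_mul (is_derive_id x (1 : R)) IHn.
rewrite (_ : (fun y => _) = (fun y => y * y ^+ n)).
  by apply: is_derive_eq; rewrite -natr1 mul1r /=; case: n {IHn h} => [|n] /=; rewrite ?exprS; ring.
by apply/funext => y; rewrite exprS.
Qed.

(** By the mean value theorem, x^(m+1) / (m+1)! - u(x) is nonnegative for x >= 0; the same for -u
    gives the absolute value, and reflection gives negative x. *)
Lemma growth_bound (r r' : R -> R) (m : nat) :
  (forall x, is_derive x (1 : R) r (r' x)) -> r 0 = 0 ->
  (forall x, `|r' x| <= `|x| ^+ m / m`!%:R) ->
  forall x, `|r x| <= `|x| ^+ m.+1 / m.+1`!%:R.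
Proof.
move=> dr r0 hr.
have pos (u u' : R -> R) : (forall x, is_derive x (1 : R) u (u' x)) -> u 0 = 0 ->
    (forall x, 0 <= x -> `|u' x| <= x ^+ m / m`!%:R) ->
    forall x, 0 <= x -> u x <= x ^+ m.+1 / m.+1`!%:R.
  move=> du u0 hu x; rewrite le_eqVlt => /predU1P[<-|x0].
    by rewrite u0 expr0n mul0r.
  pose g y := y ^+ m.+1 * (m.+1`!%:R)^-1 - u y.
  have dg y : is_derive y (1 : R) g (y ^+ m / m`!%:R - u' y).
    have h := is_derive_sub (is_derive_mul (is_derive_expn m.+1 y)
      (is_derive_cst ((m.+1`!%:R)^-1 : R) y 1)) (du y).
    apply: is_derive_eq; rewrite /= mulr0 addr0 factS natrM; congr (_ - _).
    by field; rewrite addrC natr1 !pnatr_eq0 /= -lt0n fact_gt0.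
  have cg : continuous g.
    by move=> y; apply: differentiable_continuous; apply/derivable1_diffP/ex_derive.
  have [c + gc] := MVT x0 (fun y _ => dg y) (continuous_subspaceT cg).
  rewrite in_itv/= => /andP[c0 cx].
  have : 0 <= g x - g 0.
    rewrite gc mulr_ge0 ?subr_ge0 ?(ltW x0)//.
    by apply: le_trans (ler_norm _) (hu c (ltW c0)).
  by rewrite /g u0 expr0n mul0r !subr0 subr_ge0.
have posn (u u' : R -> R) : (forall x, is_derive x (1 : R) u (u' x)) -> u 0 = 0 ->
    (forall x, 0 <= x -> `|u' x| <= x ^+ m / m`!%:R) ->
    forall x, 0 <= x -> `|u x| <= x ^+ m.+1 / m.+1`!%:R.
  move=> du u0 hu x x0; rewrite ler_norml (pos _ _ du u0 hu)// andbT lerNl.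
  apply: (pos (fun y => - u y) (fun y => - u' y)) => //.
  - by rewrite u0 oppr0.
  - by move=> y y0; rewrite normrN hu.
move=> x; have [x0|x0] := leP 0 x.
  rewrite (ger0_norm x0); apply: (posn r r') => // y y0.
  by have := hr y; rewrite (ger0_norm y0).
have nx0 : 0 <= - x by rewrite oppr_ge0 ltW.
rewrite (ltr0_norm x0).
have E : - 1 * - x + 0 = x by ring.
rewrite -{1}E.
apply: (posn (fun y => r (- 1 * y + 0)) (fun y => r' (- 1 * y + 0) * - 1)) => //.
- by move=> y; exact: (is_derive1_comp (dr _) (is_derive_affine y (- 1) 0)).
- by rewrite mulr0 addr0.
- move=> y y0; have := hr (- 1 * y + 0).
  by rewrite normrM normrN1 mulr1 addr0 mulN1r normrN (ger0_norm y0).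
Qed.

(** The j-th derivative of cos at c is written cos(c + j pi / 2), without a case distinction modulo
    4. *)
Definition cos_taylor_rem (m : nat) (c x : R) : R :=
  cos (x + c) - \sum_(j < m) x ^+ j / j`!%:R * cos (c + j%:R * (pi / 2)).

(** Differentiating the remainder in x lowers m by one and shifts c by pi / 2; the induction
    therefore runs over all c, with [growth_bound] as its step. *)
Lemma cos_taylor_rem_bound m c x : `|cos_taylor_rem m c x| <= `|x| ^+ m / m`!%:R.
Proof.
elim: m c x => [|m IHm] c x.
  rewrite /cos_taylor_rem big_ord0 subr0 expr0 fact0 divr1.
  by rewrite ler_norml cos_geN1 cos_le1.
apply: (@growth_bound (cos_taylor_rem m.+1 c) (cos_taylor_rem m (c + pi / 2))) => //.
- move=> {}x.
  have d1 : is_derive x (1 : R) (fun y => cos (y + c)) (- sin (x + c)).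
    have := is_derive_cos_affine x 1 c; rewrite mul1r mulN1r.
    by under eq_fun do rewrite mul1r.
  pose f (j : nat) y := y ^+ j * ((j`!%:R)^-1 * cos (c + j%:R * (pi / 2))).
  pose df (j : nat) := j%:R * x ^+ j.-1 * ((j`!%:R)^-1 * cos (c + j%:R * (pi / 2))).
  have dfj j : is_derive x (1 : R) (f j) (df j).
    have h := is_derive_mul (is_derive_expn j x)
      (is_derive_cst ((j`!%:R)^-1 * cos (c + j%:R * (pi / 2))) x 1).
    by apply: is_derive_eq; rewrite /= mulr0 addr0.
  have h := is_derive_sub d1 (@is_derive_bigsum m.+1 f df x dfj).
  rewrite /cos_taylor_rem (_ : (fun y => _) = (fun y => cos (y + c) - \sum_(i < m.+1) f i y)).
    apply: is_derive_eq; rewrite /cos_taylor_rem addrA cosDpihalf; congr (_ - _).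
    rewrite big_ord_recl /df mul0r mul0r add0r; apply: eq_bigr => i _.
    rewrite /= /bump/= add1n.
    have -> : c + i.+1%:R * (pi / 2) = c + pi / 2 + i%:R * (pi / 2) by rewrite -natr1; ring.
    rewrite factS natrM.
    by field; rewrite addrC natr1 !pnatr_eq0 /= -lt0n fact_gt0.
  apply/funext => y; congr (_ - _); apply: eq_bigr => i _.
  by rewrite /f -[LHS]mulrA.
- rewrite /cos_taylor_rem big_ord_recl big1 => [|i _].
    by rewrite expr0 fact0 divr1 mul1r mul0r addr0 add0r addr0 subrr.
  by rewrite expr0n /= mul0r mul0r.
Qed.

Lemma bp_closure_eq a (S : set (R -> R)) f g :
  f =1 g -> bp_closure a S f -> bp_closure a S g.
Proof. by move=> /funext ->. Qed.

Lemma bp_closure_scale a (S : set (R -> R)) (c : R) f :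
  bp_closure a S f -> bp_closure a S (fun x => c * f x).
Proof.
move=> bf; apply: bp_closure_eq (bp_lin c bf (bp_zero a S)) => x.
by rewrite addr0.
Qed.

Lemma bp_closure_add a (S : set (R -> R)) f g :
  bp_closure a S f -> bp_closure a S g -> bp_closure a S (fun x => f x + g x).
Proof.
by move=> bf bg; apply: bp_closure_eq (bp_lin 1 bf bg) => x; rewrite mul1r.
Qed.

Lemma bp_closure_sub a (S : set (R -> R)) f g :
  bp_closure a S f -> bp_closure a S g -> bp_closure a S (fun x => f x - g x).
Proof.
move=> bf bg; apply: bp_closure_eq (bp_lin (-1) bg bf) => x.
by rewrite mulN1r addrC.
Qed.

Lemma bp_closure_sum a (S : set (R -> R)) n (c : nat -> R) (f : nat -> R -> R) :
  (forall i, (i < n)%N -> bp_closure a S (f i)) ->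
  bp_closure a S (fun x => \sum_(i < n) c i * f i x).
Proof.
elim: n => [|n IHn] bf.
  by apply: bp_closure_eq (bp_zero a S) => x; rewrite big_ord0.
apply: (@bp_closure_eq a S (fun x => c n * f n x + \sum_(i < n) c i * f i x)).
  by move=> x; rewrite big_ord_recr addrC.
apply: bp_lin; first exact: bf.
by apply: IHn => i ni; apply: bf; rewrite ltnS ltnW.
Qed.

Section limit_point_family.
Context (a k0 : R) (D : set R) (a0 : 0 < a) (lp : limit_point D k0).

Let S := [set f : R -> R | exists2 k, D k & f = fun x => cos (k * (2 * x))].

Lemma limit_point_seq : exists h : nat -> R,
  [/\ forall n, D (k0 + h n), forall n, h n != 0, forall n, `|h n| <= 1 &
      h n @[n --> \oo] --> (0 : R)].
Proof.
have H (n : nat) : exists y : R, [/\ y != 0, D (k0 + y) & `|y| < n.+1%:R^-1].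
  have n0 : 0 < n.+1%:R^-1 :> R by rewrite invr_gt0 ltr0Sn.
  have [y [yk0 Dy yb]] := lp (nbhsx_ballx k0 _ n0).
  exists (y - k0); split; first by rewrite subr_eq0.
    by rewrite addrC subrK.
  by rewrite distrC.
have [h hP] := choice H; exists h; split.
- by move=> n; have [] := hP n.
- by move=> n; have [] := hP n.
- move=> n; have [_ _ /ltW hn] := hP n; apply: le_trans hn _.
  by rewrite invf_le1 ?ltr0Sn// ler1n.
- apply/cvgrPdist_lt => e e0.
  have [N _ hN] : \forall n \near \oo, harmonic n < e :> R.
    have := @cvg_harmonic R; move/cvgrPdist_lt => /(_ _ e0) [N _ hN].
    by exists N => // n /hN /=; rewrite sub0r normrN ger0_norm// ltW// harmonic_gt0.
  exists N => // n /hN /= hn; rewrite sub0r normrN.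
  by have [_ _ hn'] := hP n; exact: lt_trans hn' hn.
Qed.

(* The m-th derivative of k |-> cos (k * (2 * x)) at k0. *)
Let dcos (m : nat) x := (2 * x) ^+ m * cos (k0 * (2 * x) + m%:R * (pi / 2)).

Let cos_expand m x h : cos ((k0 + h) * (2 * x)) =
  \sum_(j < m) h ^+ j / j`!%:R * dcos j x + cos_taylor_rem m (k0 * (2 * x)) (h * (2 * x)).
Proof.
have -> : \sum_(j < m) h ^+ j / j`!%:R * dcos j x =
    \sum_(j < m) (h * (2 * x)) ^+ j / j`!%:R * cos (k0 * (2 * x) + j%:R * (pi / 2)).
  by apply: eq_bigr => j _; rewrite /dcos [(h * _) ^+ j]exprMn; ring.
by rewrite /cos_taylor_rem [RHS]addrC subrK -mulrDl [h + k0]addrC.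
Qed.

Let dcos_bound m x : 0 <= x <= a -> `|dcos m x| <= (2 * a) ^+ m.
Proof.
move=> /andP[x0 xa]; rewrite normrM -[leRHS]mulr1 ler_pM//.
  by rewrite normrX ger0_norm ?mulr_ge0// lerXn2r ?nnegrE ?mulr_ge0 ?(ltW a0)// ler_pM2l.
by rewrite ler_norml cos_geN1 cos_le1.
Qed.

(** Strong induction. Subtracting the lower Taylor terms, already in the closure, and multiplying by
    m! / h^m gives a divided difference that tends to the m-th derivative as h -> 0 with k0 + h in
    D. The case m = 0 yields the frequency k0 itself, which may lie outside D. *)
Let bp_dcos m : bp_closure a S (dcos m).
Proof.
have [h [Dh h0 h1 hlim]] := limit_point_seq.
have [N] := ubnP m; elim: N m => // N IHN m; rewrite ltnS => mN.
pose f_ n x := (m`!%:R / h n ^+ m) *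
  (cos ((k0 + h n) * (2 * x)) - \sum_(j < m) h n ^+ j / j`!%:R * dcos j x).
have f_E n x : f_ n x - dcos m x =
    (m`!%:R / h n ^+ m) * cos_taylor_rem m.+1 (k0 * (2 * x)) (h n * (2 * x)).
  rewrite /f_ (cos_expand m.+1) big_ord_recr /=.
  by field; rewrite expf_neq0 ?h0// pnatr_eq0 -lt0n fact_gt0.
have f_d n x : 0 <= x <= a -> `|f_ n x - dcos m x| <= `|h n| * (2 * a) ^+ m.+1.
  move=> xa; rewrite f_E normrM.
  have hb := cos_taylor_rem_bound m.+1 (k0 * (2 * x)) (h n * (2 * x)).
  have hp : 0 < `|h n| by rewrite normr_gt0.
  have fp j : 0 < j`!%:R :> R by rewrite ltr0n fact_gt0.
  apply: le_trans (ler_wpM2l (normr_ge0 _) hb) _.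
  rewrite normrM normfV normrX [`|m`!%:R|]gtr0_norm// normrM exprMn.
  have -> : m`!%:R / `|h n| ^+ m * (`|h n| ^+ m.+1 * `|2 * x| ^+ m.+1 / m.+1`!%:R) =
    `|h n| * (`|2 * x| ^+ m.+1 / m.+1%:R).
    rewrite factS natrM exprS; field.
    by rewrite expf_neq0 ?gt_eqF//= addrC natr1 pnatr_eq0.
  rewrite ler_wpM2l//; case/andP: xa => x0 xa.
  apply: (@le_trans _ _ (`|2 * x| ^+ m.+1)).
    by rewrite ler_pdivrMr ?ltr0Sn// ler_peMr ?exprn_ge0// ler1n.
  by rewrite ger0_norm ?mulr_ge0// lerXn2r ?nnegrE ?mulr_ge0 ?(ltW a0)// ler_pM2l.
have ap j : 0 <= (2 * a) ^+ j by rewrite exprn_ge0// mulr_ge0// ltW.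
apply: (@bp_lim _ a S f_ _ ((2 * a) ^+ m.+1 + (2 * a) ^+ m)).
- move=> n; apply: bp_closure_scale; apply: bp_closure_sub.
    by apply: bp_base; exists (k0 + h n).
  apply: (@bp_closure_sum a S m (fun j => h n ^+ j / j`!%:R) dcos) => j jm.
  by apply: IHN; exact: leq_trans jm mN.
- move=> n x xa; rewrite -(subrK (dcos m x) (f_ n x)).
  apply: le_trans (ler_normD _ _) _; apply: lerD; last exact: dcos_bound.
  by apply: le_trans (f_d n x xa) _; rewrite ler_piMl.
- move=> x xa; apply/cvgrPdist_le => e e0.
  have c0 : 0 < (2 * a) ^+ m.+1 + 1 by rewrite ltr_wpDl.
  have e1 : 0 < e / ((2 * a) ^+ m.+1 + 1) by rewrite divr_gt0.
  move/cvgrPdist_le : hlim => /(_ _ e1)[M _ hM]; exists M => // n /hM /=.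
  rewrite sub0r normrN distrC ler_pdivlMr// => hn.
  apply: le_trans (f_d n x xa) _; apply: le_trans hn.
  by rewrite ler_wpM2l// lerDl.
Qed.

(** The cosine is entire in k: its Taylor series at k0 converges for every k, uniformly for x in
    [0,a], with remainder below the n-th term of an exponential series. *)
Lemma bp_closure_cos k : bp_closure a S (fun x => cos (k * (2 * x))).
Proof.
pose h := k - k0; have kE : k = k0 + h by rewrite addrC subrK.
pose y := `|h| * (2 * a).
have y0 : 0 <= y by rewrite mulr_ge0// mulr_ge0// ltW.
pose S_ (n : nat) x := \sum_(j < n) h ^+ j / j`!%:R * dcos j x.
have rb n x : 0 <= x <= a -> `|cos (k * (2 * x)) - S_ n x| <= exp_coeff y n.
  move=> /andP[x0 xa]; rewrite kE (cos_expand n) addrAC subrr add0r.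
  apply: le_trans (cos_taylor_rem_bound _ _ _) _; rewrite exp_coeffE mulrC.
  rewrite ler_wpM2l ?invr_ge0// normrM [`|2 * x|]ger0_norm ?mulr_ge0//.
  rewrite lerXn2r ?nnegrE ?mulr_ge0 ?(ltW a0)// ler_wpM2l// ler_pM2l//.
have cy : exp_coeff y n @[n --> \oo] --> (0 : R).
  exact: cvg_series_cvg_0 (is_cvg_series_exp_coeff y).
have [B hB] : exists B : R, forall n, exp_coeff y n <= B.
  have : cvgn (exp_coeff y) by apply/cvg_ex; exists 0.
  move=> /cvg_seq_bounded[B [_ hB]]; exists (B + 1) => n.
  apply: le_trans (ler_norm _) _; apply: hB => //.
  by rewrite ltrDl.
apply: (@bp_lim _ a S S_ _ (1 + B)).
- by move=> n; apply: (@bp_closure_sum a S n (fun j => h ^+ j / j`!%:R) dcos).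
- move=> n x xa; rewrite (_ : S_ n x = cos (k * (2 * x)) - (cos (k * (2 * x)) - S_ n x)).
    apply: le_trans (ler_normB _ _) _; apply: lerD.
      by rewrite ler_norml cos_geN1 cos_le1.
    exact: le_trans (rb n x xa) (hB n).
  by ring.
- move=> x xa; apply/cvgrPdist_le => e e0.
  move/cvgrPdist_le : cy => /(_ _ e0)[M _ hM]; exists M => // n /hM /=.
  rewrite sub0r normrN => hn; apply: le_trans (rb n x xa) _.
  exact: le_trans (ler_norm _) hn.
Qed.

Lemma bp_closure_poly (l : R) (p : {poly R}) :
  bp_closure a S (fun x => p.[cos (l * (2 * x))]).
Proof.
(* The extra factor cos(2kx) lets the induction close: by the product-to-sum formula, one more power
   of cos(2lx) replaces k by k + l and k - l. *)
have mono n : forall k, bp_closure a S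
    (fun x => cos (l * (2 * x)) ^+ n * cos (k * (2 * x))).
  elim: n => [|n IHn] k.
    by apply: bp_closure_eq (bp_closure_cos k) => x; rewrite expr0 mul1r.
  apply: bp_closure_eq (bp_closure_add (bp_closure_scale 2^-1 (IHn (k + l)))
    (bp_closure_scale 2^-1 (IHn (k - l)))) => x.
  have e1 : cos ((k + l) * (2 * x)) = cos (k * (2 * x)) * cos (l * (2 * x)) -
      sin (k * (2 * x)) * sin (l * (2 * x)) by rewrite mulrDl cosD.
  have e2 : cos ((k - l) * (2 * x)) = cos (k * (2 * x)) * cos (l * (2 * x)) +
      sin (k * (2 * x)) * sin (l * (2 * x)) by rewrite mulrBl cosB.
  by rewrite exprS e1 e2; field.
apply: (@bp_closure_eq a S (fun x => \sum_(i < size p) p`_i *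
    (cos (l * (2 * x)) ^+ i * cos (0 * (2 * x))))).
  by move=> x; rewrite horner_coef; apply: eq_bigr => i _; rewrite mul0r cos0 mulr1.
exact: (@bp_closure_sum a S (size p) (fun i => p`_i)
  (fun i x => cos (l * (2 * x)) ^+ i * cos (0 * (2 * x)))).
Qed.

End limit_point_family.
End closure_of_cosines.

(** * Indicators as limits of polynomials in a cosine *)

Section indicator_approximation.
Context {R : realType}.
Implicit Types (u z r s a al x : R).

Lemma bernoulli_lower u (m : nat) : 0 <= u <= 1 -> 1 - m%:R * u <= (1 - u) ^+ m.
Proof.
move=> /andP[u0 u1]; elim: m => [|m IHm]; first by rewrite mul0r subr0 expr0.
have v0 : 0 <= 1 - u by rewrite subr_ge0.
rewrite exprS; apply: le_trans (ler_wpM2l v0 IHm).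
have : 0 <= m%:R * u ^+ 2 by rewrite mulr_ge0// sqr_ge0.
by rewrite -natr1; lra.
Qed.

Lemma bernoulli_upper u (m : nat) : 0 <= u <= 1 -> (1 - u) ^+ m * (1 + m%:R * u) <= 1.
Proof.
move=> /andP[u0 u1]; elim: m => [|m IHm]; first by rewrite mul0r addr0 expr0 mulr1.
have v0 : 0 <= 1 - u by rewrite subr_ge0.
apply: le_trans IHm; rewrite exprSr -mulrA ler_wpM2l ?exprn_ge0//.
have : 0 <= m%:R * u ^+ 2 by rewrite mulr_ge0// sqr_ge0.
have : 0 <= u ^+ 2 by rewrite sqr_ge0.
by rewrite -natr1; lra.
Qed.

(** With s = sqrt r, Bernoulli's inequality bounds n s^n by 1 / (1 - s), and a factor s^n is left
    over. *)
Lemma cvg_nat_mul_geometric r : 0 <= r < 1 -> n%:R * r ^+ n @[n --> \oo] --> (0 : R).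
Proof.
move=> /andP[r0 r1]; pose s := Num.sqrt r.
have s0 : 0 <= s by exact: sqrtr_ge0.
have s1 : s < 1 by rewrite -sqrtr1 ltr_sqrt.
have sr : r = s ^+ 2 by rewrite sqr_sqrtr.
have gs : (1 - s)^-1 * s ^+ n @[n --> \oo] --> (0 : R).
  rewrite -(mulr0 (1 - s)^-1); apply: cvgM; first exact: cvg_cst.
  by apply: cvg_expr; rewrite ger0_norm.
have cc : (0 : R) @[n --> \oo] --> (0 : R) by exact: cvg_cst.
apply: squeeze_cvgr cc gs; apply: nearW => n.
rewrite mulr_ge0 ?exprn_ge0//= sr -exprM mulnC exprM expr2 mulrA.
rewrite ler_wpM2r ?exprn_ge0//.
have v0 : 0 < 1 - s by rewrite subr_gt0.
have := @bernoulli_upper (1 - s) n; rewrite (ltW v0) lerBlDr lerDl s0 => /(_ isT).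
rewrite opprB addrC subrK => h; rewrite -[leRHS]mul1r ler_pdivlMr//.
apply: le_trans h.
have -> : n%:R * s ^+ n * (1 - s) = s ^+ n * (n%:R * (1 - s)) by ring.
by rewrite [leRHS]mulrDr mulr1 lerDr exprn_ge0.
Qed.

(* The exponents are chosen so that n 2^n z^n = n (2 z)^n tends to 0 for
   z < 1/2 and to infinity for z >= 1/2. *)
Definition step_value (n : nat) z : R := (1 - z ^+ n) ^+ (n * 2 ^ n).

Lemma step_value_itv n z : 0 <= z <= 1 -> 0 <= step_value n z <= 1.
Proof.
move=> /andP[z0 z1].
have zn : 0 <= z ^+ n <= 1 by rewrite exprn_ge0// exprn_ile1.
rewrite /step_value exprn_ge0 ?subr_ge0 ?(andP zn).2//= exprn_ile1 ?subr_ge0 ?(andP zn).2//.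
by rewrite lerBlDr lerDl (andP zn).1.
Qed.

Lemma step_value_exponent n z : (n * 2 ^ n)%:R * z ^+ n = n%:R * (2 * z) ^+ n.
Proof. by rewrite natrM natrX exprMn mulrA. Qed.

Lemma step_value_below z : 0 <= z < 2^-1 -> step_value n z @[n --> \oo] --> (1 : R).
Proof.
move=> /andP[z0 zh].
have r : 0 <= 2 * z < 1.
  by rewrite mulr_ge0//= mulrC -ltr_pdivlMr// div1r.
have z1 : z <= 1 by apply: ltW (lt_trans zh _); rewrite invf_lt1// ltr1n.
have lo : 1 - n%:R * (2 * z) ^+ n @[n --> \oo] --> (1 : R).
  rewrite -[X in _ --> X](subr0 1); apply: cvgB; first exact: cvg_cst.
  exact: cvg_nat_mul_geometric.
have cc : (1 : R) @[n --> \oo] --> (1 : R) by exact: cvg_cst.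
apply: squeeze_cvgr lo cc; apply: nearW => n.
have := @step_value_itv n z; rewrite z0 z1 => /(_ isT) /andP[_ ->].
rewrite andbT -step_value_exponent; apply: bernoulli_lower.
by rewrite exprn_ge0// exprn_ile1.
Qed.

(** Bernoulli's inequality gives at most 1 / (1 + n (2z)^n), hence at most 1 / (n + 1). This
    includes z = 1/2, which decides the value of the limit at the jump. *)
Lemma step_value_above z : 2^-1 <= z <= 1 -> step_value n z @[n --> \oo] --> (0 : R).
Proof.
move=> /andP[zh z1].
have z0 : 0 <= z by apply: le_trans zh; rewrite invr_ge0.
have cc : (0 : R) @[n --> \oo] --> (0 : R) by exact: cvg_cst.
apply: squeeze_cvgr cc (@cvg_harmonic R); apply: nearW => n.
have := @step_value_itv n z; rewrite z0 z1 => /(_ isT) /andP[s0 _].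
rewrite s0 /= /harmonic /= -[leRHS]mul1r ler_pdivlMr ?ltr0Sn//.
have := @bernoulli_upper (z ^+ n) (n * 2 ^ n).
rewrite exprn_ge0// exprn_ile1// => /(_ isT); apply: le_trans.
rewrite ler_wpM2l// step_value_exponent -natr1 addrC lerD2l.
rewrite ler_peMr// exprn_ege1//.
by rewrite mulrC -ler_pdivrMr// div1r.
Qed.

Lemma bp_closure_indicator a k0 (D : set R) al : 0 < a -> limit_point D k0 -> 0 <= al <= a ->
  bp_closure a [set f | exists2 k, D k & f = fun x => cos (k * (2 * x))]
    (fun x => if al < x then 1 else 0).
Proof.
move=> a0 lp /andP[al0 ala].
(* With this l the angle 2 l x runs through [0, pi] as x runs through [0, a], and the cosine is
   strictly decreasing there. *)
pose l := pi / (2 * a); pose y0 := cos (l * (2 * al)).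
(* An affine image of the cosine equal to 1/2 exactly at [al]. Two cosines differ by at most 2, so
   dividing by 4 keeps z in [0, 1]. *)
pose z x := 2^-1 + (cos (l * (2 * x)) - y0) / 4.
pose p (n : nat) : {poly R} :=
  (1 - ((2^-1 - y0 / 4)%:P + (4^-1)%:P * 'X) ^+ n) ^+ (n * 2 ^ n).
have pE n x : (p n).[cos (l * (2 * x))] = step_value n (z x).
  rewrite /p /step_value /z horner_exp hornerD hornerC hornerN horner_exp hornerD hornerM.
  rewrite !hornerC hornerX; congr ((1 - _ ^+ _) ^+ _).
  by field.
have lE x : l * (2 * x) = pi * (x / a) by rewrite /l; field; rewrite gt_eqF.
have zb x : 0 <= z x <= 1.
  have c1 := cos_geN1 (l * (2 * x)); have c2 := cos_le1 (l * (2 * x)).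
  have c3 := cos_geN1 (l * (2 * al)); have c4 := cos_le1 (l * (2 * al)).
  by rewrite /z /y0; lra.
have itv x : 0 <= x <= a -> l * (2 * x) \in `[0, pi]%R.
  move=> /andP[x0 xa]; rewrite lE in_itv/= mulr_ge0 ?pi_ge0 ?divr_ge0 ?(ltW a0)//=.
  by rewrite ler_piMr ?pi_ge0// ler_pdivrMr// mul1r.
have mono x x' : 0 <= x <= a -> 0 <= x' <= a ->
    (cos (l * (2 * x)) < cos (l * (2 * x'))) = (x' < x).
  move=> xi xi'; rewrite ltr_cos ?itv// !lE ltr_pM2l ?pi_gt0// ltr_pM2r// invr_gt0//.
have ali : 0 <= al <= a by rewrite al0.
apply: (@bp_lim _ a _ (fun n x => (p n).[cos (l * (2 * x))]) _ 1).
- by move=> n; exact: (bp_closure_poly a0 lp).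
- move=> n x xa; rewrite pE; have /andP[s0 s1] := @step_value_itv n _ (zb x).
  by rewrite ger0_norm.
- move=> x xa; under eq_fun do rewrite pE.
  have /andP[z0 z1] := zb x.
  case: ifPn => alx.
    apply: step_value_below; rewrite z0 /=.
    by have := mono _ _ xa ali; rewrite alx -/y0 /z => h; lra.
  apply: step_value_above; rewrite z1 andbT.
  by have := mono _ _ xa ali; rewrite (negbTE alx) -/y0 /z => /negbT; rewrite -leNgt; lra.
Qed.

End indicator_approximation.

(** * Uniqueness *)

Section vanishing.
Context {R : realType}.
Implicit Types (p : R -> R) (a x y al be : R).

Lemma Rintegral_mul_step (f : R -> R) al a : 0 <= al <= a ->
  \int[mu]_(x in `[0, a]) (f x * (if al < x then 1 else 0)) = \int[mu]_(x in `]al, a]) f x.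
Proof.
move=> /andP[al0 ala].
have -> : `]al, a]%classic = `[0, a]%classic `&` `]al, +oo[%classic.
  apply/seteqP; split=> x /=; rewrite !in_itv/= ?andbT.
    by move=> /andP[alx ->]; rewrite alx (le_trans al0 (ltW alx)).
  by move=> [/andP[_ ->] ->].
rewrite Rintegral_mkcondr; apply: eq_Rintegral => x _.
rewrite patchE; case: ifPn => h.
  by rewrite ifT ?mulr1// inE/= in_itv/= h.
by rewrite ifF ?mulr0//; apply/negbTE; rewrite notin_setE/= in_itv/= andbT; exact/negP.
Qed.

Lemma measurable_step al a :
  measurable_fun (`[0, a]%classic : set R) (fun x : R => if al < x then 1 else 0 : R).
Proof.
apply: measurable_funTS.
rewrite (_ : (fun x : R => _) = \1_(`]al, +oo[%classic)); first exact: measurable_indic.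
by apply/funext => x; rewrite indicE mem_setE in_itv/= andbT; case: ifP.
Qed.

Lemma ae_neq (c : R) : {ae @lebesgue_measure R, forall x : R, x <> c}.
Proof.
exists [set c]; split => //; first exact: lebesgue_measure_set1.
by move=> x /= /contrapT.
Qed.

(* A bound of the mass of [p] on intervals by their lengths makes [p] bounded
   almost everywhere by [C * \int_x^a |p|], to which Gronwall's argument applies. *)
Lemma interval_bound_vanish p a (C : R) : 0 < a -> 0 <= C ->
  (@lebesgue_measure R).-integrable setT (EFin \o p) ->
  (forall al be, 0 <= al -> al < be -> be <= a ->
    `|\int[mu]_(x in `]al, be]) p x| <=
    C * (be - al) * \int[mu]_(x in `[al, a]) `|p x|) ->
  {ae @lebesgue_measure R, forall x : R, 0 < x -> x < a -> p x = 0}.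
Proof.
move=> a0 C0 ip H.
have ipS A : measurable A -> mu.-integrable A (EFin \o p).
  by move=> mA; exact: integrableS ip.
have ipn A : measurable A -> mu.-integrable A (EFin \o (fun x => `|p x|)).
  by move=> mA; have := integrable_norm (ipS A mA).
pose Q x := \int[mu]_(y in `[x, a]) `|p y|.
have Q0 x : 0 <= Q x by exact: Rintegral_ge0.
have Qmono x y : x <= y -> Q y <= Q x.
  move=> xy; apply: le_Rintegral_subset => //; last exact: ipn.
  by move=> z /=; rewrite !in_itv/= => /andP[yz ->]; rewrite (le_trans xy).
pose G (x : R) : R := \int[mu]_(t in [set` Interval (BLeft 0) (BRight x)]) p t.
have locp : locally_integrable [set: R] p.
  by apply: open_integrable_locally => //; exact: openT.
have aeG : {ae @lebesgue_measure R, forall x : R, 0 < x ->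
    derivable G x 1 /\ G^`()%classic x = p x}.
  have := @FTC1 R p (BLeft 0) (fun y => ipS _ (measurable_itv _)) locp.
  by move=> h; apply: (ae_imply h) => x hx x0; apply: hx; rewrite /= lte_fin.
(* The lower limit is frozen at [al] so that one null set serves for all x in ]al, a[. The bound on
   p is the limit of the mean values of p over ]x, x + h]. *)
have aeb al : 0 <= al -> {ae @lebesgue_measure R, forall x : R, al < x < a ->
    `|p x| <= C * Q al}.
  move=> al0; apply: (ae_imply aeG) => x hx /andP[alx xa].
  have [dG Gx] := hx (le_lt_trans al0 alx).
  apply/ler_addgt0Pr => e e0.
  have lim : h^-1 *: ((G \o shift x) (h *: (1 : R)) - G x) @[h --> 0^'] --> p x.
    by rewrite -Gx derive1E; exact: dG.
  move/cvgrPdist_le : lim => /(_ _ e0)[r /= r0 hr].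
  pose h := Num.min (r / 2) (a - x).
  have h0 : 0 < h by rewrite lt_min divr_gt0//= subr_gt0.
  have hr2 : h < r.
    by rewrite gt_min; apply/orP; left; rewrite ltr_pdivrMr// ltr_pMr// ltr1n.
  have := hr h; rewrite /= sub0r normrN gtr0_norm// => /(_ hr2 (lt0r_neq0 h0)).
  rewrite [h%:A]mulr1 [h + x]addrC => hh.
  have xh : x + h <= a by rewrite -lerBrDl ge_min lexx orbT.
  have GB : G (x + h) - G x = \int[mu]_(t in `]x, x + h]) p t.
    rewrite /G Rintegral_itvB//; first exact: ipS.
      by rewrite bnd_simp; apply: ltW; exact: le_lt_trans alx.
    by rewrite bnd_simp lerDl ltW.
  have x0 : 0 <= x by apply: ltW; exact: le_lt_trans alx.
  have xlt : x < x + h by rewrite ltrDl.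
  have := H x (x + h) x0 xlt xh; rewrite -GB addrAC subrr add0r => hb.
  rewrite -(subrK (h^-1 *: (G (x + h) - G x)) (p x)) addrC.
  apply: le_trans (ler_normD _ _) _; apply: lerD => //.
  rewrite normrZ normfV (gtr0_norm h0) ler_pdivrMl//.
  apply: le_trans hb _; rewrite mulrAC mulrC ler_wpM2l ?(ltW h0)//.
  by rewrite ler_wpM2l// Qmono// ltW.
(* If p has no mass beyond [be], then Q(al) is its mass on [al, be], at most C Q(al) (be - al) <=
   Q(al) / 2, hence zero. *)
have small al be : 0 <= al -> al <= be -> be <= a -> Q be = 0 ->
    C * (be - al) <= 2^-1 -> Q al = 0.
  move=> al0 alb ba Qb Cs.
  have Qsplit : Q al = \int[mu]_(x in `[al, be]) `|p x|.
    have := @Rintegral_itvB R (fun y => `|p y|) (BLeft al) (BRight a) be.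
    rewrite !bnd_simp => /(_ (ipn _ (measurable_itv _)) alb ba).
    rewrite Rintegral_itv_obnd_cbnd; last exact: ipn.
    by rewrite -/(Q be) Qb -/(Q al) => /eqP; rewrite subr_eq0 => /eqP.
  have Qle : Q al <= C * Q al * (be - al).
    rewrite {1}Qsplit -lee_fin /Rintegral fineK; last first.
      by apply: integrable_fin_num => //; exact: ipn.
    have mp : measurable_fun (`[al, be]%classic : set R) (EFin \o p).
      by case/integrableP : (ipS `[al, be]%classic (measurable_itv _)).
    have CQ0 : (0 <= (C * Q al)%:E)%E by rewrite lee_fin mulr_ge0.
    have ab : {ae @lebesgue_measure R, forall x, (`[al, be]%classic : set R) x ->
        (`|(EFin \o p) x| <= (C * Q al)%:E)%E}.
      apply: (ae_imply2 (aeb al al0) (ae_imply2 (ae_neq al) (ae_neq a) (fun x h1 h2 => conj h1 h2))).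
      move=> x h [xal xa] /=; rewrite in_itv/= => /andP[alx xb]; rewrite lee_fin h//.
      rewrite !lt_neqAle alx (le_trans xb ba) !andbT eq_sym.
      by apply/andP; split; apply/eqP.
    have mE : @lebesgue_measure R `[al, be]%classic = (be - al)%:E.
      rewrite lebesgue_measure_itv/= lte_fin; case: ltP => // h.
      by congr (_%:E); lra.
    rewrite EFinM -mE.
    exact: (@integral_le_bound _ _ _ mu _ _ _ (measurable_itv _) mp CQ0 ab).
  apply/eqP; rewrite eq_le Q0 andbT.
  have : C * Q al * (be - al) <= 2^-1 * Q al by rewrite mulrAC ler_wpM2r.
  by move: Qle; lra.
have Qa : Q a = 0 by rewrite /Q set_itv1 Rintegral_set1.
(* A step length with C d <= 1/2; the added 1 covers C = 0. The vanishing of Q is then carried from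
   a down to 0 in steps of d. *)
pose d := (2 * (C + 1))^-1.
have C1 : 0 < 2 * (C + 1) by rewrite mulr_gt0// ltr_wpDl.
have d0 : 0 < d by rewrite invr_gt0.
have Cd : C * d <= 2^-1.
  by rewrite /d invfM mulrCA ler_piMr ?invr_ge0// ler_pdivrMr ?ltr_wpDl// mul1r lerDl.
have iter (n : nat) : Q (Num.max 0 (a - n%:R * d)) = 0.
  elim: n => [|n IHn]; first by rewrite mul0r subr0 max_r// ltW.
  have nd : 0 <= n%:R * d by rewrite mulr_ge0// ltW.
  have nE : n.+1%:R * d = n%:R * d + d by rewrite -natr1 mulrDl mul1r.
  apply: (small _ (Num.max 0 (a - n%:R * d))) => //.
  - by rewrite le_max lexx.
  - by rewrite ge_max le_max lexx/= le_max; apply/orP; right; rewrite nE; lra.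
  - by rewrite ge_max (ltW a0)/=; lra.
  - apply: le_trans Cd; rewrite ler_wpM2l// nE.
    by case: (leP 0 (a - n%:R * d)); case: (leP 0 (a - (n%:R * d + d))); lra.
have Q00 : Q 0 = 0.
  have [n hn] : exists n : nat, a <= n%:R * d.
    exists (Num.truncn (a / d)).+1; rewrite -ler_pdivrMr//; apply: ltW.
    exact: truncnS_gt.
  by have := iter n; rewrite max_l// subr_le0.
apply: (ae_imply (aeb 0 (lexx _))) => x h x0 xa.
by apply/eqP; rewrite -normr_le0; have := h; rewrite x0 xa Q00 mulr0; apply.
Qed.

End vanishing.

(** * From cosine sums to intervals *)

Section uniqueness.
Context {R : realType}.
Implicit Types (p q : R -> R) (a x y al be : R).

(** The hypothesis is applied to a cosine sum close to the indicator of ]al, be]: up to the error d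
    its mass is 0 before [al] and at most be - al after it, so the mass of |p| on [0, al] enters
    with the factor d only. *)
Lemma interval_bound_of_test_functions p a k0 (D : set R) (C : R) : 0 < a -> 0 <= C ->
  (@lebesgue_measure R).-integrable setT (EFin \o p) -> limit_point D k0 ->
  (forall n (c k : 'I_n -> R), (forall i, D (k i)) ->
    forall al B M : R, 0 <= al <= a ->
    (forall y, 0 <= y <= al -> \int[mu]_(x in `[0, y]) `|cosine_sum c k (2 * x)| <= B) ->
    (forall y, al <= y <= a -> \int[mu]_(x in `[0, y]) `|cosine_sum c k (2 * x)| <= M) ->
    `|\int[mu]_(x in `[0, a]) (p x * (cosine_sum c k (2 * x) + cosine_sum c k 0))| <=
    C * (B * \int[mu]_(x in `[0, al]) `|p x| + M * \int[mu]_(x in `[al, a]) `|p x|)) ->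
  forall al be, 0 <= al -> al < be -> be <= a ->
    `|\int[mu]_(x in `]al, be]) p x| <=
    C * (be - al) * \int[mu]_(x in `[al, a]) `|p x|.
Proof.
move=> a0 C0 ip lp H al be al0 alb ba.
have ala : 0 <= al <= a by rewrite al0 (le_trans (ltW alb)).
have bea : 0 <= be <= a by rewrite (le_trans al0 (ltW alb)).
have ipS A : measurable A -> mu.-integrable A (EFin \o p).
  by move=> mA; exact: integrableS ip.
have ipn A : measurable A -> mu.-integrable A (EFin \o (fun x => `|p x|)).
  by move=> mA; have := integrable_norm (ipS A mA).
pose S := [set f | exists2 k, D k & f = fun x : R => cos (k * (2 * x))].
pose st (c x : R) : R := if c < x then 1 else 0.
pose ind x := st al x - st be x.
have bind : bp_closure a S ind.
  by apply: bp_closure_sub; apply: bp_closure_indicator lp _.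
have mst c : measurable_fun (`[0, a]%classic : set R) (st c) by exact: measurable_step.
have mind : measurable_fun (`[0, a]%classic : set R) ind by exact: measurable_funB.
have st01 c x : 0 <= st c x <= 1 by rewrite /st; case: ifP; rewrite ?lexx ?ler01.
have indb x : `|ind x| <= 1.
  have /andP[h1 h2] := st01 al x; have /andP[h3 h4] := st01 be x.
  by rewrite ler_norml /ind; lra.
have ind_ge0 x : 0 <= ind x.
  rewrite /ind /st; case: (ltP be x) => bx; last by rewrite subr0; case: ifP.
  by rewrite (lt_trans alb bx) subrr.
have c1 : continuous (fun _ : R => 1 : R) by move=> z; exact: cvg_cst.
have i1 : mu.-integrable `[0, a] (EFin \o (fun=> 1 : R)) by exact: continuous_integrable_itv.
have istep (f : R -> R) c : mu.-integrable `[0, a] (EFin \o f) ->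
    mu.-integrable `[0, a] (EFin \o (fun x => f x * st c x)).
  move=> intf; apply: (integrable_mul_bounded intf (mst c) (M := 1)) => x _.
  by have /andP[h1 h2] := st01 c x; rewrite ger0_norm.
(* One weighted distance controls both the integral against p and the plain L^1 distance needed for
   the bounds B and M. *)
pose w x := `|p x| + 1.
have w0 x : 0 <= w x by rewrite addr_ge0.
have iw : mu.-integrable `[0, a] (EFin \o w).
  by have := integrableD _ (ipn _ (measurable_itv `[0, a])) i1; apply; exact: measurable_itv.
have Iind : \int[mu]_(x in `[0, a]) ind x = be - al.
  have E c : 0 <= c <= a -> \int[mu]_(x in `[0, a]) st c x = a - c.
    move=> ca; have := Rintegral_mul_step (fun=> 1) ca.
    under eq_Rintegral do rewrite mul1r.
    move=> ->; rewrite Rintegral_itv_obnd_cbnd; last first.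
      by apply: integrableS i1 => //; apply: subset_itvr; case/andP: ca.
    by rewrite Rintegral_itv_cst ?mul1r//; case/andP: ca.
  have is1 c : mu.-integrable `[0, a] (EFin \o st c).
    by apply: eq_integrable (istep _ c i1) => // x _ /=; rewrite mul1r.
  by rewrite RintegralB// !E//; ring.
have Ip : \int[mu]_(x in `[0, a]) (p x * ind x) = \int[mu]_(x in `]al, be]) p x.
  have E := Rintegral_mul_step p.
  under eq_Rintegral do rewrite mulrBr.
  rewrite RintegralB//; [|exact: istep (ipS _ (measurable_itv _))..].
  rewrite !E// -(@Rintegral_itvB _ p (BRight al) (BRight a) be) ?bnd_simp ?(ltW alb)//.
  - by rewrite subKr.
  - exact: ipS.
set L := \int[mu]_(x in `[0, a]) `|p x|; set Q := \int[mu]_(x in `[al, a]) `|p x|.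
have L0 : 0 <= L by exact: Rintegral_ge0.
have Q0 : 0 <= Q by exact: Rintegral_ge0.
apply/ler_addgt0Pr => e e0.
(* K is the total coefficient of d in the final inequality, plus 1 to make it positive. *)
pose K := C * (\int[mu]_(x in `[0, al]) `|p x| + Q) + 1 + L + 1.
have K0 : 0 < K.
  by rewrite /K ltr_wpDl// !addr_ge0// mulr_ge0// addr_ge0// Rintegral_ge0.
have d0 : 0 < e / K by rewrite divr_gt0.
set d := e / K in d0.
have [_ _ /(_ d d0)[n [c [k [Dk z iz]]]]] := bp_closure_approx a0 iw w0 bind.
pose Th x := cosine_sum c k (2 * x).
have cTh : continuous Th by exact: continuous_cosine_sum2.
have ind00 : ind 0 = 0 by rewrite /ind /st ltNge al0 ltNge (le_trans al0 (ltW alb)) subrr.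
rewrite ind00 sub0r normrN in z.
have mTh : measurable_fun (`[0, a]%classic : set R) Th.
  by apply: measurable_funTS; exact: continuous_measurable_fun.
have [N N0 hN] := continuous_bounded_itv 0 a cTh.
have mdiff : measurable_fun (`[0, a]%classic : set R) (fun x => `|ind x - Th x|).
  by apply: measurableT_comp => //; exact: measurable_funB.
have bdiff x : 0 <= x <= a -> `|(`|ind x - Th x|)| <= 1 + N.
  move=> xa; rewrite normr_id; apply: le_trans (ler_normB _ _) _.
  by rewrite lerD ?indb ?hN.
have idw := integrable_mul_bounded iw mdiff bdiff.
have id1 : mu.-integrable `[0, a] (EFin \o (fun x => `|ind x - Th x|)).
  apply: eq_integrable (integrable_mul_bounded i1 mdiff bdiff) => // x _ /=.
  by rewrite mul1r.
have idp := integrable_mul_bounded (ipn _ (measurable_itv `[0, a])) mdiff bdiff.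
have D1 : \int[mu]_(x in `[0, a]) `|ind x - Th x| <= d.
  apply: ltW; apply: le_lt_trans iz; apply: le_Rintegral => // x _.
  by rewrite ler_peMl// lerDr.
have Dp : \int[mu]_(x in `[0, a]) (`|p x| * `|ind x - Th x|) <= d.
  apply: ltW; apply: le_lt_trans iz; apply: le_Rintegral => // x _.
  by rewrite ler_wpM2r// lerDl.
have iind : mu.-integrable `[0, a] (EFin \o ind).
  apply: eq_integrable (integrable_mul_bounded i1 mind (fun x _ => indb x)) => // x _ /=.
  by rewrite mul1r.
have sub0a y : y <= a -> `[0, y]%classic `<=` (`[0, a]%classic : set R).
  by move=> ya x /=; rewrite !in_itv/= => /andP[-> xy]; exact: le_trans xy ya.
have Thle y : y <= a -> \int[mu]_(x in `[0, y]) `|Th x| <=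
    \int[mu]_(x in `[0, y]) ind x + d.
  move=> ya; apply: le_trans (lerD (lexx _) D1).
  have id1y : mu.-integrable `[0, y] (EFin \o (fun x => `|ind x - Th x|)).
    by apply: integrableS id1 => //; exact: sub0a.
  have iindy : mu.-integrable `[0, y] (EFin \o ind).
    by apply: integrableS iind => //; exact: sub0a.
  apply: (@le_trans _ _ (\int[mu]_(x in `[0, y]) ind x +
      \int[mu]_(x in `[0, y]) `|ind x - Th x|)); last first.
    rewrite lerD2l; apply: le_Rintegral_subset => //; exact: sub0a.
  rewrite -RintegralD//; apply: le_Rintegral => //.
  - by apply: continuous_integrable_itv; exact: continuous_normr.
  - by have := integrableD _ iindy id1y; apply; exact: measurable_itv.
  - move=> x _; rewrite -{1}(subKr (ind x) (Th x)).
    by apply: le_trans (ler_normB _ _) _; rewrite (ger0_norm (ind_ge0 x)).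
have hB y : 0 <= y <= al -> \int[mu]_(x in `[0, y]) `|Th x| <= d.
  move=> /andP[y0 yal]; apply: le_trans (Thle y _) _; first by case/andP: ala => _; exact: le_trans.
  rewrite (_ : \int[mu]_(x in `[0, y]) ind x = 0) ?add0r//.
  rewrite -[RHS](mul0r (fine (mu (`[0, y]%classic : set R)))) -Rintegral_cst//.
  apply: eq_Rintegral => x; rewrite inE/= in_itv/= => /andP[x0 xy].
  rewrite /ind /st ltNge (le_trans xy yal) ltNge.
  by rewrite (le_trans (le_trans xy yal) (ltW alb)) subrr.
have hM y : al <= y <= a -> \int[mu]_(x in `[0, y]) `|Th x| <= (be - al) + d.
  move=> /andP[y0 ya]; apply: le_trans (Thle y ya) _; rewrite lerD2r -Iind.
  by apply: le_Rintegral_subset => //; exact: sub0a.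
have main := H n c k Dk al d (be - al + d) ala hB hM.
have th0 : `|\int[mu]_(x in `[0, a]) (p x * cosine_sum c k 0)| <= d * L.
  rewrite RintegralZr//; last exact: ipS.
  rewrite normrM mulrC; apply: ler_pM => //; first exact: ltW.
  by apply: le_normr_Rintegral => //; exact: ipS.
have ipTh : mu.-integrable `[0, a] (EFin \o (fun x => p x * Th x)).
  by apply: integrable_mul_continuous => //; exact: ipS.
have ipind : mu.-integrable `[0, a] (EFin \o (fun x => p x * ind x)).
  exact: integrable_mul_bounded (ipS _ (measurable_itv _)) mind (fun x _ => indb x).
have ipc : mu.-integrable `[0, a] (EFin \o (fun x => p x * cosine_sum c k 0)).
  by apply: integrable_mul_continuous; [exact: ipS|move=> z'; exact: cvg_cst].
have dif : `|\int[mu]_(x in `[0, a]) (p x * ind x) - \int[mu]_(x in `[0, a]) (p x * Th x)| <= d.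
  rewrite -RintegralB//; apply: le_trans Dp.
  apply: le_trans (le_normr_Rintegral _ _) _ => //.
    by have := integrableB _ ipind ipTh; apply; exact: measurable_itv.
  rewrite le_eqVlt; apply/orP; left; apply/eqP; apply: eq_Rintegral => x _.
  by rewrite -mulrBr normrM.
have split : \int[mu]_(x in `[0, a]) (p x * (Th x + cosine_sum c k 0)) =
    \int[mu]_(x in `[0, a]) (p x * Th x) + \int[mu]_(x in `[0, a]) (p x * cosine_sum c k 0).
  by rewrite -RintegralD//; apply: eq_Rintegral => x _; rewrite mulrDr.
rewrite -/(Th _) in main; rewrite split -/Q in main.
rewrite -Ip.
set i := \int[mu]_(x in `[0, a]) (p x * ind x) in dif *.
set t := \int[mu]_(x in `[0, a]) (p x * Th x) in dif main *.
set t0 := \int[mu]_(x in `[0, a]) (p x * cosine_sum c k 0) in th0 main *.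
have -> : i = (i - t) + ((t + t0) - t0) by ring.
apply: le_trans (ler_normD _ _) _.
apply: le_trans (lerD dif (ler_normB _ _)) _.
apply: le_trans (lerD (lexx d) (lerD main th0)) _.
have eK : e = d * K by rewrite /d divfK// gt_eqF.
rewrite eK /K; set q0 := \int[mu]_(x in `[0, al]) `|p x|.
have -> : d + (C * (d * q0 + (be - al + d) * Q) + d * L) =
   C * (be - al) * Q + d * (C * (q0 + Q) + 1 + L) by ring.
by rewrite lerD2l ler_wpM2l ?(ltW d0)// lerDl.
Qed.

End uniqueness.

(** * Reduction of the potentials and of the data *)

Section data.
Context {R : realType}.
Implicit Types (q : R -> R) (k x a : R).

(** The potentials are controlled on ]0, +oo[ only, while the integration lemmas ask for
    integrability on the whole line. *)
Definition zero_extension q : R -> R := q \_ `]0, +oo[.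

Lemma zero_extension_pos q x : 0 < x -> zero_extension q x = q x.
Proof. by move=> x0; rewrite /zero_extension patchE ifT// inE/= in_itv/= x0. Qed.

Lemma integrable_zero_extension q :
  (@lebesgue_measure R).-integrable `]0, +oo[ (EFin \o q) ->
  (@lebesgue_measure R).-integrable setT (EFin \o zero_extension q).
Proof. by move=> iq; rewrite -restrict_EFin -integrable_mkcond. Qed.

Lemma jost_solution_zero_extension q k (u : R -> R[i]) :
  jost_solution q k u -> jost_solution (zero_extension q) k u.
Proof.
move=> [[h1 h2 h3] h4]; split => //; split => //.
by apply: (ae_imply h3) => x h x0; rewrite zero_extension_pos//; exact: h.
Qed.

(** Allowing every b >= a makes the larger of two such bounds valid for both potentials. *)
Lemma compactly_supported_bound q : compactly_supported q ->
  exists2 a : R, 0 < a & forall b, a <= b ->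
    {ae @lebesgue_measure R, forall x : R, b < x -> zero_extension q x = 0}.
Proof.
move=> [K /compact_bounded[M [_ hM]] hK].
exists (`|M| + 1) => [|b Mb]; first by rewrite ltr_wpDl.
have M1 : M < `|M| + 1 by rewrite ltr_pwDr// ler_norm.
have M0 : 0 < `|M| + 1 by rewrite ltr_wpDl.
apply: (ae_imply hK) => x h bx; have x0 : 0 < x := lt_trans (lt_le_trans M0 Mb) bx.
rewrite zero_extension_pos//; apply: h => // Kx.
have := hM _ M1 x Kx; rewrite /= (gtr0_norm x0) leNgt.
by rewrite (le_lt_trans Mb bx).
Qed.

Lemma limit_point_open (U : set R) x : open U -> U x -> limit_point U x.
Proof.
move=> oU Ux V Vx.
have [r /= r0 hr] : nbhs x (U `&` V) by apply: filterI => //; exact: open_nbhs_nbhs.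
have xr : ball_ Num.norm x r (x + r / 2).
  rewrite /ball_/= opprD addrA subrr sub0r normrN gtr0_norm ?divr_gt0//.
  by rewrite ltr_pdivrMr// ltr_pMr// ltr1n.
have [Ur Vr] := hr _ xr.
by exists (x + r / 2); split => //; rewrite -subr_eq0 addrAC subrr add0r gt_eqF// divr_gt0.
Qed.

Lemma limit_point_subset (A B : set R) x : A `<=` B -> limit_point A x -> limit_point B x.
Proof. by move=> AB lA U /lA[y [yx /AB By Uy]]; exists y. Qed.

End data.

Theorem mainTheorem10 (R : realType) (q1 q2 : R -> R)
    (f1 f2 : R -> R -> R[i]%C)
    (hq1 : (@lebesgue_measure R).-integrable `]0, +oo[ (EFin \o q1))
    (hq2 : (@lebesgue_measure R).-integrable `]0, +oo[ (EFin \o q2))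
    (hs1 : compactly_supported q1)
    (hs2 : compactly_supported q2)
    (hf1 : forall k : R, 0 < k -> jost_solution q1 k (fun x => f1 x k))
    (hf2 : forall k : R, 0 < k -> jost_solution q2 k (fun x => f2 x k))
    (hdata :
      (exists U : set R, [/\ open U, U !=set0, U `<=` `]0, +oo[ &
         forall k : R, U k ->
           cderive (fun x => f1 x k) 0 = cderive (fun x => f2 x k) 0])
      \/
      (exists k_ : nat -> R, [/\ injective k_, forall n, 0 < k_ n,
         exists2 k : R, 0 < k & limit_point (range k_) k &
         forall n, cderive (fun x => f1 x (k_ n)) 0
                 = cderive (fun x => f2 x (k_ n)) 0])) :
  {ae @lebesgue_measure R, forall x : R, 0 < x -> q1 x = q2 x}.
Proof.
pose Q1 := zero_extension q1; pose Q2 := zero_extension q2.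
have iQ1 := integrable_zero_extension hq1; have iQ2 := integrable_zero_extension hq2.
have iQ1b b : mu.-integrable `[0, b] (EFin \o Q1) by exact: integrableS iQ1.
have iQ2b b : mu.-integrable `[0, b] (EFin \o Q2) by exact: integrableS iQ2.
pose p x := Q1 x - Q2 x.
have ip : (@lebesgue_measure R).-integrable setT (EFin \o p).
  by have := integrableB _ iQ1 iQ2; apply; exact: measurableT.
have [a1 a10 s1] := compactly_supported_bound hs1.
have [a2 a20 s2] := compactly_supported_bound hs2.
pose a := Num.max a1 a2.
have a0 : 0 < a by rewrite lt_max a10.
have z1 : {ae @lebesgue_measure R, forall x : R, a < x -> Q1 x = 0}.
  by apply: s1; rewrite le_max lexx.
have z2 : {ae @lebesgue_measure R, forall x : R, a < x -> Q2 x = 0}.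
  by apply: s2; rewrite le_max lexx orbT.
(* All frequencies of agreement are gathered in one set, and the two forms of the data merge: each
   gives a limit point of D. *)
pose D := [set k : R | 0 < k /\
  cderive (fun x => f1 x k) 0 = cderive (fun x => f2 x k) 0].
have [k0 lp] : exists k0 : R, limit_point D k0.
  case: hdata => [[U [oU [k0 Uk0] U0 hU]]|[k_ [_ kpos [k0 _ lp] hk]]]; exists k0.
    apply: limit_point_subset (limit_point_open oU Uk0) => k Uk.
    by split; [have := U0 _ Uk; rewrite /= in_itv/= andbT|exact: hU].
  by apply: limit_point_subset lp => _ [n _ <-]; split; [exact: kpos|exact: hk].
have sols (k : R) : D k -> exists phi : (R -> R) * (R -> R),
    [/\ duhamel_solution Q1 a k phi.1, duhamel_solution Q2 a k phi.2 &
        \int[mu]_(x in `[0, a]) (p x * (phi.1 x * phi.2 x)) = 0].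
  move=> [kpos Ek].
  have [u1 [v1' [r1 u10 v10 e1]]] := jost_regular_solution kpos a0 iQ1b z1
    (jost_solution_zero_extension (hf1 k kpos)).
  have [u2 [v2' [r2 u20 v20 e2]]] := jost_regular_solution kpos a0 iQ2b z2
    (jost_solution_zero_extension (hf2 k kpos)).
  exists (u1, u2) => /=; split.
  - split; first exact: (rs_continuous r1).
    by move=> x /andP[x0 _]; apply: (duhamel kpos x0 iQ1b r1).
  - split; first exact: (rs_continuous r2).
    by move=> x /andP[x0 _]; apply: (duhamel kpos x0 iQ2b r2).
  - rewrite (wronskian_int (ltW a0) iQ1b iQ2b r1 r2) u10 u20 v10 v20.
    have [-> ->] := e1 a (lexx a); have [-> ->] := e2 a (lexx a).
    by rewrite Ek; ring.
have [C C0 HC] := orthogonal_products_bound a0 iQ1 iQ2 ip.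
have vanish : {ae @lebesgue_measure R, forall x : R, 0 < x -> x < a -> p x = 0}.
  apply: (interval_bound_vanish a0 C0 ip).
  apply: (interval_bound_of_test_functions a0 C0 ip lp) => n c k Dk.
  have [phi phiP] := choice (fun i => sols _ (Dk i)).
  apply: (HC n c k (fun i => (phi i).1) (fun i => (phi i).2)) => i.
  - by case: (Dk i).
  - by case: (phiP i).
  - by case: (phiP i).
  - by case: (phiP i).
(* Both potentials vanish beyond a and p vanishes before it; the point a itself is discarded as a
   null set. *)
apply: (ae_imply2 vanish (ae_imply2 (ae_neq a) (ae_imply2 z1 z2
  (fun x h1 h2 => conj h1 h2)) (fun x h1 h2 => conj h1 h2))) => x px [xa [q1x q2x]] x0.
rewrite -(zero_extension_pos q1 x0) -(zero_extension_pos q2 x0) -/(Q1 x) -/(Q2 x).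
have [xlt|xgt|//] := ltgtP x a; last by rewrite q1x// q2x.
by apply/eqP; rewrite -subr_eq0; apply/eqP; exact: px.
Qed.
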